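(* Let $W = SO(3)$ and let $G \subset \mathrm{Aut}(SO(3)) = SO(3)$ be an arbitrary finite subgroup, of order $n$. Let $SO(3)/G$ be the corresponding coset $n$-valued topological group (the orbit space of the action of $G$ on $SO(3)$ by conjugation, with the quotient topology). If $n$ is even, then $SO(3)/G$ is homeomorphic to the sphere $S^3$. If $n$ is odd, then $SO(3)/G$ is homeomorphic to the real projective space $\mathbb{R}P^3$.
   Context: **$n$-valued topological group.** A Hausdorff path-connected topological space $X$ with a base point $e \in X$, together with a continuous $n$-valued multiplication $\mu\colon X\times X \to \mathrm{Sym}^n X = X^n/S_n$ and a continuous involution $\mathrm{inv}\colon X\to X$ with $\mathrm{inv}(e)=e$, is called an $n$-valued topological group if: (1) $\mu(x,\mu(y,z)) = \mu(\mu(x,y),z) \in \mathrm{Sym}^{n^2}X$ for all $x,y,z\in X$; (2) $\mu(x,e)=\mu(e,x)=[x,x,\ldots,x]$ for all $x\in X$; (3) $\mu(x,\mathrm{inv}(x))\ni e$ and $\mu(\mathrm{inv}(x),x)\ni e$ for all $x\in X$. **Coset $n$-valued group.** Let $W$ be a compact connected Lie group and $G=\{g_1,\ldots,g_n\}\subset \mathrm{Aut}(W)$ a subgroup of order $n$ of its group of (Lie group) automorphisms. Let $X = W/G$ be the orbit space of the action of $G$ on $W$ by automorphisms, with the quotient topology, and let $\pi\colon W\to X$ be the canonical projection. Then $X$ is an $n$-valued topological group with identity $e=\pi(e_W)$, inverse $\mathrm{inv}(\pi(w)) = \pi(w^{-1})$, and multiplication $\mu(\pi(a),\pi(b)) =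 [\pi(a g_1(b)),\pi(a g_2(b)),\ldots,\pi(a g_n(b))]$ for all $a,b\in W$. This is called the coset $n$-valued topological group $W/G$. (It is not the space of cosets of a subgroup of $W$.) **Identification.** Every automorphism of $SO(3)$ is conjugation $x\mapsto gxg^{-1}$ by a unique element $g\in SO(3)$, so $\mathrm{Aut}(SO(3))$ is identified with $SO(3)$. Thus a finite subgroup $G\subset SO(3)$ acts on $W = SO(3)$ by conjugation, and $SO(3)/G$ denotes the orbit space of this conjugation action. *)

(* Defs.v *)
From HB Require Import structures.
From mathcomp Require Import all_boot all_order all_algebra.
From mathcomp Require Import all_classical all_reals all_analysis.

Set Implicit Arguments.
Unset Strict Implicit.
Unset Printing Implicit Defensive.

Import Order.TTheory GRing.Theory Num.Theory.
Import numFieldNormedType.Exports.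

Local Open Scope classical_set_scope.
Local Open Scope ring_scope.
Local Open Scope quotient_scope.

Definition homeomorphic (X Y : topologicalType) : Prop :=
  exists f : X -> Y, exists g : Y -> X,
    [/\ cancel f g, cancel g f, continuous f & continuous g].

Section SpecialOrthogonal.
Context {R : realType} {m : nat}.

Definition SO_set : set 'M[R]_m :=
  [set A | A *m A^T = 1%:M /\ \det A = 1].

Lemma SO_set1 : SO_set 1%:M.
Proof. by split; rewrite ?trmx1 ?mulmx1 ?det1. Qed.

Lemma SO_setM A B : SO_set A -> SO_set B -> SO_set (A *m B).
Proof.
move=> [AAt dA] [BBt dB]; split; last by rewrite det_mulmx dA dB mulr1.
by rewrite trmx_mul mulmxA -(mulmxA A) BBt mulmx1.
Qed.

Lemma SO_setT A : SO_set A -> SO_set A^T.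
Proof. by move=> [AAt dA]; split; rewrite ?det_tr ?trmxK//; exact: mulmx1C. Qed.

End SpecialOrthogonal.

(* [set_type] carries the topology induced by that of 'M[R]_m. *)
Definition SO (R : realType) (m : nat) : Type := set_type (@SO_set R m).

Section SpecialOrthogonalGroup.
Context {R : realType} {m : nat}.
Local Notation SO := (SO R m).

HB.instance Definition _ := SubType.copy SO (set_type (@SO_set R m)).
HB.instance Definition _ := Topological.copy SO (set_type (@SO_set R m)).

Definition SO_one : SO := SigSub (mem_set (@SO_set1 R m)).

Definition SO_mul (x y : SO) : SO :=
  SigSub (mem_set (SO_setM (set_valP x) (set_valP y))).

Definition SO_inv (x : SO) : SO := SigSub (mem_set (SO_setT (set_valP x))).

Lemma SO_mulA : associative SO_mul.
Proof. by move=> x y z; apply: val_inj; rewrite /= mulmxA. Qed.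

Lemma SO_mul1 : left_id SO_one SO_mul.
Proof. by move=> x; apply: val_inj; rewrite /= mul1mx. Qed.

Lemma SO_mulr1 : right_id SO_one SO_mul.
Proof. by move=> x; apply: val_inj; rewrite /= mulmx1. Qed.

Lemma SO_mulV : left_inverse SO_one SO_inv SO_mul.
Proof.
by move=> x; apply: val_inj => /=; apply: mulmx1C; have [] := set_valP x.
Qed.

Lemma SO_mulrV : right_inverse SO_one SO_inv SO_mul.
Proof. by move=> x; apply: val_inj => /=; have [] := set_valP x. Qed.

HB.instance Definition _ :=
  isGroup.Build SO SO_mulA SO_mul1 SO_mulr1 SO_mulV SO_mulrV.

End SpecialOrthogonalGroup.

Section CosetSpace.
Context {R : realType} {m : nat} (G : groupClosed (SO R m)).
Local Notation SO := (SO R m).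

(* [g] in [SO] acts as the automorphism [x |-> g * x * g^-1]; MathComp's [x ^ g]
   is conjugation by [g^-1]. *)
Definition conj_orbit_rel : rel SO :=
  fun x y => `[< exists2 g, g \in G & y = (g * x * g^-1)%g >].

Lemma conj_orbit_equiv : equiv_class_of conj_orbit_rel.
Proof.
split=> [x|x y|y x z].
- by apply/asboolP; exists 1%g; rewrite ?gpred1// invg1 mulg1 mul1g.
- by apply/asboolP/asboolP => -[g gG ->]; exists g^-1%g;
    rewrite ?gpredV// invgK !mulgA mulVg mul1g -mulgA mulVg mulg1.
- move=> /asboolP[g gG ->] /asboolP[h hG ->]; apply/asboolP.
  by exists (h * g)%g; rewrite ?gpredM// invgM !mulgA.
Qed.

Canonical conj_orbit_equiv_rel := EquivRelPack conj_orbit_equiv.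

(* The underlying topological space of the coset n-valued group. *)
Definition coset_space : topologicalType :=
  quotient_topology {eq_quot conj_orbit_equiv_rel}.

End CosetSpace.

Section SphereProjectiveSpace.
Context (R : realType) (d : nat).

(* The library norm on matrices is the sup norm, so the Euclidean one is spelled
   out. *)
Definition sphere_set : set 'rV[R]_d.+1 :=
  [set x | \sum_(i < d.+1) x ord0 i ^+ 2 = 1].

Definition sphere : topologicalType := set_type sphere_set.

Definition antipodal_rel : rel sphere :=
  fun x y => (set_val y == set_val x) || (set_val y == - set_val x).

Lemma antipodal_equiv : equiv_class_of antipodal_rel.
Proof.
split=> [x|x y|y x z]; rewrite /antipodal_rel ?eqxx//.
- by rewrite eq_sym -eqr_oppLR (eq_sym (- _)).
- by move=> /orP[]/eqP yE /orP[]/eqP ->; rewrite yE ?opprK eqxx ?orbT.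
Qed.

Canonical antipodal_equiv_rel := EquivRelPack antipodal_equiv.

(* [projective_space R d] is RP^d, the sphere S^d in R^(d + 1) with antipodal
   points identified. *)
Definition projective_space : topologicalType :=
  quotient_topology {eq_quot antipodal_equiv_rel}.

End SphereProjectiveSpace.

(* Main.v *)
From mathcomp Require Import all_boot all_order all_algebra.
From mathcomp Require Import all_classical all_reals all_analysis.
From mathcomp Require Import ring lra complex.
Require Import Defs.

(** The unit quaternions cover SO(3) twice: [t + v] with imaginary part [v] goes
to the rotation [rodrigues t v], and only [t + v] and [- t - v] have the same
image. Conjugation by a rotation [g] lifts to [t + v |-> t + g v]
([rodrigues_conj]). So SO(3)/G is the quotient of the 3-sphere by the group
that is generated by -1 and by G acting on imaginary parts, and everything
rests on an explicit description of the orbits of G on vectors and of the way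
in which [v |-> - v] permutes them.

The orbit map. Let [n] be the order of G and fix a rotation [c]. Put
[y_g = c g v] for [g] in G and let [P], [Q], [W] be the products over G of
[|v| + y_g3], [|v| - y_g3] and of the complex numbers [y_g1 + i y_g2]. They are
invariant under G and [|W|^2 = P Q], so that
  [orbit_map v = |v| / (P + Q) (2 Re W, 2 Im W, P - Q)]
is invariant and has the same length as [v]. The denominator vanishes at no
[v != 0] as soon as no element of G reverses the axis that [c] sends to the
third one, which holds for [c] in general position ([generic_frame]).

Why it is onto and separates orbits. Vectors are the values of the Hopf map on
spinors [z] in C^2, and every rotation lifts to a linear map of C^2
([spin_lift]). If [l_g] and [m_g] are the coordinates of the lift of [c g],
then the orbit map carries the direction of [hopf z] to that of [hopf (F z)]
with [F z] the pair of the products of the [l_g z] and of the [m_g z]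
([orbit_map_hopf]): on the projective line it is a rational function of degree
[n]. It is onto because C is algebraically closed. For a fixed [w], the
condition that [F z] and [F w] be proportional is a form of degree [n] in [z]
that vanishes on the orbit of [w]. When that orbit has [n] points, the form is
therefore proportional to the product of the [n] linear forms vanishing at
these points. This proportionality is an identity between polynomials in [w];
since it holds for generic [w], it holds for all [w], including those with a
nontrivial stabiliser ([orbit_form_fibre]).

Parity. Replacing [v] by [- v] exchanges [P] and [Q] and multiplies [W] by
[(-1)^n]. If [n] is odd, [orbit_map] is odd, hence [t + v |-> t + orbit_map v]
transforms -1 into the antipodal map of the 3-sphere, whose quotient is the
projective space. If [n] is even, [orbit_map (- v)] is the mirror image of
[orbit_map v] in the third coordinate; then -1 is transformed into the
half-turn which changes the signs of [t] and of the third imaginary coordinate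
[y], and the quotient by this half-turn is again a 3-sphere: replace the
complex number [t + i y] by its square divided by its modulus ([fold_sphere]).

Each of these maps is a continuous surjection from the 3-sphere, which is
compact, onto a Hausdorff space, so that equality of fibres is enough to
produce a homeomorphism between the quotients ([homeomorphic_quotients]). *)

Set Implicit Arguments.
Unset Strict Implicit.
Unset Printing Implicit Defensive.

Import Order.TTheory GRing.Theory Num.Theory.
Import numFieldNormedType.Exports.

Local Open Scope classical_set_scope.
Local Open Scope card_scope.
Local Open Scope ring_scope.

(** * Vectors and matrices of size three *)

Section SizeThree.
Variable R : comNzRingType.

Lemma forall_I3 (P : 'I_3 -> Prop) : P 0 -> P 1 -> P 2 -> forall i, P i.
Proof.
move=> P0 P1 P2 [[|[|[|//]]] lti].
- by rewrite (_ : Ordinal lti = 0) //; apply: val_inj.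
- by rewrite (_ : Ordinal lti = 1) //; apply: val_inj.
- by rewrite (_ : Ordinal lti = 2) //; apply: val_inj.
Qed.

Lemma sum_I3 (V : nmodType) (F : 'I_3 -> V) : \sum_(i < 3) F i = F 0 + F 1 + F 2.
Proof.
rewrite !big_ord_recr big_ord0 /= add0r.
by congr (F _ + F _ + F _); apply: val_inj.
Qed.

Lemma det_mx33 (A : 'M[R]_3) : \det A =
  A 0 0 * (A 1 1 * A 2 2 - A 1 2 * A 2 1) - A 0 1 * (A 1 0 * A 2 2 - A 1 2 * A 2 0)
  + A 0 2 * (A 1 0 * A 2 1 - A 1 1 * A 2 0).
Proof.
pose a i j := A (inord i) (inord j).
have aE i j : A i j = a i j by rewrite /a !inord_val.
rewrite !aE (expand_det_row _ 0) sum_I3 /cofactor !(expand_det_row _ 0).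
rewrite !big_ord_recl !big_ord0 /cofactor !det_mx11 !mxE !aE /=.
rewrite /bump /= !(addn0, add0n, expr0, expr1, mul1r, add1n).
ring.
Qed.
End SizeThree.

Definition vec3 (R : Type) (a b c : R) : 'cV[R]_3 :=
  \col_i if i == 0 then a else if i == 1 then b else c.

Lemma vec3E (R : Type) (a b c : R) :
  ((vec3 a b c 0 0 = a) * (vec3 a b c 1 0 = b) * (vec3 a b c 2 0 = c))%type.
Proof. by rewrite !mxE. Qed.

Lemma vec3P (R : Type) (v w : 'cV[R]_3) :
  v 0 0 = w 0 0 -> v 1 0 = w 1 0 -> v 2 0 = w 2 0 -> v = w.
Proof. by move=> *; apply/matrixP => + j; rewrite ord1; apply: forall_I3. Qed.

Definition mat3 (R : Type) (r0 r1 r2 : 'cV[R]_3) : 'M[R]_3 :=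
  \matrix_(i, j) (if i == 0 then r0 else if i == 1 then r1 else r2) j 0.

Lemma mat3E (R : Type) (r0 r1 r2 : 'cV[R]_3) j :
  ((mat3 r0 r1 r2 0 j = r0 j 0) * (mat3 r0 r1 r2 1 j = r1 j 0) *
   (mat3 r0 r1 r2 2 j = r2 j 0))%type.
Proof. by rewrite !mxE. Qed.

Lemma mat3P (R : Type) (A B : 'M[R]_3) :
  A 0 0 = B 0 0 -> A 0 1 = B 0 1 -> A 0 2 = B 0 2 ->
  A 1 0 = B 1 0 -> A 1 1 = B 1 1 -> A 1 2 = B 1 2 ->
  A 2 0 = B 2 0 -> A 2 1 = B 2 1 -> A 2 2 = B 2 2 -> A = B.
Proof. by move=> *; apply/matrixP; apply: forall_I3; apply: forall_I3. Qed.

(** * Rotations and unit quaternions *)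

Section Rotations.
Variable R : comNzRingType.
Implicit Types (v w : 'cV[R]_3) (M A : 'M[R]_3) (t : R).

Definition dot v w : R := v 0 0 * w 0 0 + v 1 0 * w 1 0 + v 2 0 * w 2 0.
Definition sqn v : R := dot v v.

Lemma mulmx_vec3 M v i :
  (M *m v) i 0 = M i 0 * v 0 0 + M i 1 * v 1 0 + M i 2 * v 2 0.
Proof. by rewrite mxE sum_I3. Qed.

Lemma mulmx_mat3 M A i j :
  (M *m A) i j = M i 0 * A 0 j + M i 1 * A 1 j + M i 2 * A 2 j.
Proof. by rewrite mxE sum_I3. Qed.

(** The matrix of [x |-> q x q^-1] on imaginary quaternions, where [q = t + v]
is a unit quaternion. *)
Definition rodrigues t v : 'M[R]_3 :=
  let d := t * t - sqn v in let a := v 0 0 in let b := v 1 0 in let c := v 2 0 in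
  mat3 (vec3 (d + 2 * a * a) (2 * a * b - 2 * t * c) (2 * a * c + 2 * t * b))
       (vec3 (2 * b * a + 2 * t * c) (d + 2 * b * b) (2 * b * c - 2 * t * a))
       (vec3 (2 * c * a - 2 * t * b) (2 * c * b + 2 * t * a) (d + 2 * c * c)).

Definition m3E := (mat3E, vec3E, mulmx_vec3, mulmx_mat3).

Lemma rodriguesN t v : rodrigues (- t) (- v) = rodrigues t v.
Proof. by apply: mat3P; rewrite !m3E /sqn /dot !mxE; ring. Qed.

Lemma rodrigues_trmx t v :
  rodrigues t v *m (rodrigues t v)^T = ((t * t + sqn v) ^+ 2)%:M.
Proof.
by apply: mat3P; rewrite !m3E ![_^T _ _]mxE !m3E !mxE /= /sqn /dot; ring.
Qed.

Lemma det_rodrigues t v : \det (rodrigues t v) = (t * t + sqn v) ^+ 3.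
Proof. by rewrite det_mx33 !m3E /sqn /dot; ring. Qed.

Definition cross v w : 'cV[R]_3 :=
  vec3 (v 1 0 * w 2 0 - v 2 0 * w 1 0) (v 2 0 * w 0 0 - v 0 0 * w 2 0)
       (v 0 0 * w 1 0 - v 1 0 * w 0 0).

(** The formula of Rodrigues. It writes the matrix with operations that every
rotation respects, whence [rodrigues_conj]. *)
Lemma rodrigues_mul t v x : rodrigues t v *m x =
  (t * t - sqn v) *: x + (2 * dot v x) *: v + (2 * t) *: cross v x.
Proof. by apply: vec3P; rewrite m3E !mxE /= /sqn /dot; ring. Qed.

Lemma dotE v w : dot v w = (v^T *m w) 0 0.
Proof. by rewrite mxE sum_I3 !mxE. Qed.

Lemma eq_mulmx_cV (A B : 'M[R]_3) : (forall x : 'cV_3, A *m x = B *m x) -> A = B.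
Proof.
move=> AB; apply/matrixP => i j; have := AB (delta_mx j 0).
by rewrite -!colE => /matrixP/(_ i 0); rewrite !mxE.
Qed.
End Rotations.

Section RotationsOverRealField.
Variable R : realType.
Implicit Types (v w : 'cV[R]_3) (M A : 'M[R]_3) (t : R).
Local Notation is_rot := (@SO_set R 3).

Lemma rot_trmxK A : is_rot A -> A^T *m A = 1%:M.
Proof. by case=> /mulmx1C. Qed.

(** The inverse of a rotation is both its transpose and its adjugate. These
quadratic relations between the entries are what distinguishes rotations from
other orthogonal matrices in [rot_cross] and [rodrigues_surj]. *)
Lemma rot_cofactor A i j : is_rot A -> A i j = cofactor A i j.
Proof.
move=> rA; have [_ dA] := rA.
have : A^T *m (A *m \adj A) = A^T by rewrite mul_mx_adj dA mulmx1.
by rewrite mulmxA rot_trmxK// mul1mx => /matrixP/(_ j i); rewrite !mxE.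
Qed.

Lemma rot_dot A v w : is_rot A -> dot (A *m v) (A *m w) = dot v w.
Proof.
by move=> rA; rewrite !dotE trmx_mul mulmxA -(mulmxA v^T) rot_trmxK// mulmx1.
Qed.

Lemma rot_sqn A v : is_rot A -> sqn (A *m v) = sqn v.
Proof. exact: rot_dot. Qed.

Lemma cofactor33 A :
  ((cofactor A 0 0 = A 1 1 * A 2 2 - A 1 2 * A 2 1) *
  (cofactor A 0 1 = A 1 2 * A 2 0 - A 1 0 * A 2 2) *
  (cofactor A 0 2 = A 1 0 * A 2 1 - A 1 1 * A 2 0) *
  (cofactor A 1 0 = A 2 1 * A 0 2 - A 2 2 * A 0 1) *
  (cofactor A 1 1 = A 2 2 * A 0 0 - A 2 0 * A 0 2) *
  (cofactor A 1 2 = A 2 0 * A 0 1 - A 2 1 * A 0 0) *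
  (cofactor A 2 0 = A 0 1 * A 1 2 - A 0 2 * A 1 1) *
  (cofactor A 2 1 = A 0 2 * A 1 0 - A 0 0 * A 1 2) *
  (cofactor A 2 2 = A 0 0 * A 1 1 - A 0 1 * A 1 0))%type.
Proof.
pose a i j := A (inord i) (inord j).
have aE i j : A i j = a i j by rewrite /a !inord_val.
rewrite !aE /cofactor !(expand_det_row _ 0).
rewrite !big_ord_recl !big_ord0 /cofactor !det_mx11 !mxE !aE /=.
rewrite /bump /= !(addn0, add0n, expr0, expr1, mul1r, add1n).
by do ?split; ring.
Qed.

Lemma rot_cross A v w : is_rot A -> cross (A *m v) (A *m w) = A *m cross v w.
Proof.
move=> rA; apply: vec3P; rewrite !m3E.
(* With the entries of the outer A replaced by their cofactors, both sides are the
   same polynomials. *)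
- by rewrite (rot_cofactor 0 0 rA) (rot_cofactor 0 1 rA) (rot_cofactor 0 2 rA)
    !cofactor33; ring.
- by rewrite (rot_cofactor 1 0 rA) (rot_cofactor 1 1 rA) (rot_cofactor 1 2 rA)
    !cofactor33; ring.
- by rewrite (rot_cofactor 2 0 rA) (rot_cofactor 2 1 rA) (rot_cofactor 2 2 rA)
    !cofactor33; ring.
Qed.

(** This lifts the conjugation action from SO(3) to the 3-sphere, where it is
linear. *)
Lemma rodrigues_conj A t v : is_rot A ->
  A *m rodrigues t v *m A^T = rodrigues t (A *m v).
Proof.
move=> rA; have [AAT _] := rA.
suff -> : A *m rodrigues t v = rodrigues t (A *m v) *m A.
  by rewrite -mulmxA AAT mulmx1.
apply: eq_mulmx_cV => x; rewrite -!mulmxA !rodrigues_mul rot_sqn// rot_dot//.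
by rewrite rot_cross// !mulmxDr -!scalemxAr.
Qed.

Lemma rodrigues_rot t v : t * t + sqn v = 1 -> is_rot (rodrigues t v).
Proof. by move=> tv; split; rewrite ?rodrigues_trmx ?det_rodrigues tv expr1n. Qed.

(** The entries of the matrix determine the product of any two coordinates of
the quaternion, hence the quaternion up to sign. *)
Lemma rodrigues_eq s t v w : s * s + sqn v = 1 -> t * t + sqn w = 1 ->
  rodrigues s v = rodrigues t w -> (s = t /\ v = w) \/ (s = - t /\ v = - w).
Proof.
move=> sv tw /matrixP E.
have := (E 0 0, E 0 1, E 0 2, (E 1 0, E 1 1, E 1 2), (E 2 0, E 2 1, E 2 2)).
rewrite /rodrigues !m3E => -[[[[[E00 E01] E02] [[E10 E11] E12]] [[E20 E21] E22]]].
move: sv tw E00 E01 E02 E10 E11 E12 E20 E21 E22; rewrite /sqn /dot => {E}.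
have := (@vec3P _ v w, @vec3P _ v (- w)); rewrite !mxE.
move: (v 0 0) (v 1 0) (v 2 0) (w 0 0) (w 1 0) (w 2 0).
move=> a b c a' b' c' [K1 K2] sv tw E00 E01 E02 E10 E11 E12 E20 E21 E22.
(* Inner product of the two quaternions q and q'; the equalities of products
   below give q = d q', whence d = 1 or d = -1. *)
pose d := s * t + a * a' + b * b' + c * c'.
have ss : s * s = t * t by lra.
have sa : s * a = t * a' by lra.
have sb : s * b = t * b' by lra.
have sc : s * c = t * c' by lra.
have aa : a * a = a' * a' by lra.
have bb : b * b = b' * b' by lra.
have cc : c * c = c' * c' by lra.
have ab : a * b = a' * b' by lra.
have ac : a * c = a' * c' by lra.
have bc : b * c = b' * c' by lra.
have Es : s = d * t.
  transitivity (s * (t * t) + a * (t * a') + b * (t * b') + c * (t * c'));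
    last by rewrite /d; ring.
  by rewrite -ss -sa -sb -sc -{1}[s]mulr1 -sv; ring.
have Ea : a = d * a'.
  transitivity (s * (t * a') + a * (a' * a') + b * (a' * b') + c * (a' * c'));
    last by rewrite /d; ring.
  by rewrite -sa -aa -ab -ac -{1}[a]mulr1 -sv; ring.
have Eb : b = d * b'.
  transitivity (s * (t * b') + a * (a' * b') + b * (b' * b') + c * (b' * c'));
    last by rewrite /d; ring.
  by rewrite -sb -ab -bb -bc -{1}[b]mulr1 -sv; ring.
have Ec : c = d * c'.
  transitivity (s * (t * c') + a * (a' * c') + b * (b' * c') + c * (c' * c'));
    last by rewrite /d; ring.
  by rewrite -sc -ac -bc -cc -{1}[c]mulr1 -sv; ring.
have d2 : (d - 1) * (d + 1) = 0.
  have : (d * t) * (d * t) + ((d * a') * (d * a') + (d * b') * (d * b') + (d * c') *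
    (d * c')) = 1.
    by rewrite -Es -Ea -Eb -Ec.
  move=> H; transitivity (d * d - 1); first by ring.
  by rewrite -[X in _ - X]H -{1}[d * d]mulr1 -tw; ring.
move/eqP: d2; rewrite mulf_eq0 subr_eq0 addr_eq0 => /orP[]/eqP d1.
  by left; rewrite Es d1 mul1r; split=> //; apply: K1; rewrite ?Ea ?Eb ?Ec d1 mul1r.
by right; rewrite Es d1 mulN1r; split=> //; apply: K2; rewrite ?Ea ?Eb ?Ec d1 mulN1r.
Qed.

End RotationsOverRealField.

Section RodriguesSurjective.
Variable R : realType.
Implicit Types (v w : 'cV[R]_3) (M A : 'M[R]_3) (t : R).
Local Notation is_rot := (@SO_set R 3).

(** The minors that vanish make all columns proportional, so that one of them with
a positive diagonal entry gives [x] after scaling; the trace provides it. *)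
Lemma rank_one_sym4 (q : 'I_4 -> 'I_4 -> R) :
  (forall i j, q i j = q j i) ->
  (forall i j k : 'I_4, [&& (i <= j)%N, i != k :> nat & j != k :> nat] ->
     q i k * q j k = q i j * q k k) ->
  q 0 0 + q 1 1 + q 2 2 + q 3 3 = 1 ->
  exists x : 'I_4 -> R, forall i j, q i j = x i * x j.
Proof.
move=> qC qle tr.
have q1 i j k : q i k * q j k = q i j * q k k.
  have [->|ik] := eqVneq i k; first by rewrite (qC k j) mulrC.
  have [->//|jk] := eqVneq j k.
  case/orP: (leq_total i j) => ij; first by rewrite qle// ij ik.
  by rewrite mulrC (qC i j) qle// ij ik jk.
have [k k0] : exists k, 0 < q k k.
  apply: contrapT => /forallNP H.
  have {}H i : q i i <= 0 by rewrite leNgt; apply/negP/H.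
  by have := (H 0, H 1, H 2, H 3) => -[[[]]]; lra.
exists (fun i => q i k / Num.sqrt (q k k)) => i j.
by rewrite mulrACA -invfM -expr2 sqr_sqrtr ?ltW// q1 mulfK ?gt_eqF.
Qed.

(** For a unit quaternion [q], the products [q_i q_j] are affine functions of
the entries of [rodrigues q]. Evaluated at any rotation, these affine functions
form a matrix of rank one and trace one, as follows from the quadratic relations
that define the rotations. *)
Lemma rodrigues_surj A : is_rot A ->
  exists t v, t * t + sqn v = 1 /\ rodrigues t v = A.
Proof.
move=> rA; have [AAT dA] := rA; have ATA := rot_trmxK rA.
have := (fun i j => rot_cofactor i j rA) => C.
have := (C 0 0, C 0 1, C 0 2, (C 1 0, C 1 1, C 1 2), (C 2 0, C 2 1, C 2 2)).
rewrite !cofactor33 => -[[[[[C00 C01] C02] [[C10 C11] C12]] [[C20 C21] C22]]] {C}.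
move/matrixP: AAT => P.
have := (P 0 0, P 0 1, P 0 2, (P 1 1, P 1 2, P 2 2)).
rewrite !mulmx_mat3 ![_^T _ _]mxE !mxE /= => -[[[[P00 P01] P02] [[P11 P12] P22]]] {P}.
move/matrixP: ATA => P.
have := (P 0 0, P 0 1, P 0 2, (P 1 1, P 1 2, P 2 2)).
rewrite !mulmx_mat3 ![_^T _ _]mxE !mxE /= => -[[[[Q00 Q01] Q02] [[Q11 Q12] Q22]]] {P}.
clear dA rA.
have := @mat3P _ _ A.
move: (A 0 0) (A 0 1) (A 0 2) (A 1 0) (A 1 1) (A 1 2) (A 2 0) (A 2 1) (A 2 2)
  C00 C01 C02 C10 C11 C12 C20 C21 C22 P00 P01 P02 P11 P12 P22 Q00 Q01 Q02 Q11 Q12 Q22.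
move=> a b c d e f g h k C00 C01 C02 C10 C11 C12 C20 C21 C22 P00 P01 P02 P11 P12 P22
  Q00 Q01 Q02 Q11 Q12 Q22 K.
pose s : seq (seq R) := [:: 
 [:: 1 + a + e + k; h - f; c - g; d - b];
 [:: h - f; 1 + a - e - k; b + d; c + g];
 [:: c - g; b + d; 1 - a + e - k; f + h];
 [:: d - b; c + g; f + h; 1 - a - e + k]].
(* The expected value of the product of the quaternion coordinates i and j. *)
pose q (i j : 'I_4) := nth 0 (nth [::] s i) j / 4.
have [|||x qx] := @rank_one_sym4 q.
- by rewrite /q; case=> [[|[|[|[|//]]]] ?] [[|[|[|[|//]]]] ?].
- by rewrite /q; case=> [[|[|[|[|//]]]] ?] [[|[|[|[|//]]]] ?] [[|[|[|[|//]]]] ?] //=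
    _; lra.
- rewrite /q /=; lra.
exists (x 0), (vec3 (x 1) (x 2) (x 3)).
rewrite /sqn /dot !vec3E -!qx.
split; first by rewrite /q /=; lra.
apply: K; rewrite /rodrigues !m3E /sqn /dot ?vec3E -!mulrA -!qx /q /=; lra.
Qed.
End RodriguesSurjective.

(** * Binary forms over an algebraically closed field *)

Lemma horner_eq0 (K : numDomainType) (p : {poly K}) : (forall t, p.[t] = 0) -> p = 0.
Proof.
move=> p0; apply/eqP/negPn/negP => /max_poly_roots.
move=> /(_ [seq i%:R | i <- iota 0 (size p)]); rewrite size_map size_iota ltnn.
have Rinj : injective (fun i : nat => i%:R : K) by move=> i j /eqP;
  rewrite eqr_nat => /eqP.
rewrite (map_inj_uniq Rinj) iota_uniq => H; have //: false; apply: H => //.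
by apply/allP => t _; rewrite rootE p0.
Qed.

Section BinaryForms.
Variable K : numClosedFieldType.
Implicit Types (z w p : K * K) (f g : K * K -> K).

(** Its vanishing expresses equality of points of the projective line. *)
Definition wedge z w := z.1 * w.2 - z.2 * w.1.
Definition lform p z := p.1 * z.1 + p.2 * z.2.

Lemma wedgezz z : wedge z z = 0.
Proof. by rewrite /wedge mulrC subrr. Qed.

Lemma wedge_lform p q z w :
  lform p z * lform q w - lform q z * lform p w = wedge p q * wedge z w.
Proof. by rewrite /wedge /lform; ring. Qed.

Lemma lform_kernel p : exists2 z, z != 0 & lform p z = 0.
Proof.
have [->|p0] := eqVneq p 0.
  exists (1, 0); last by rewrite /lform /=; ring.
  by apply/eqP => -[] /eqP; rewrite oner_eq0.
exists (p.2, - p.1); last by rewrite /lform /=; ring.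
by apply: contraNN p0; case: p => a b /eqP[-> /eqP]; rewrite oppr_eq0 => /eqP->.
Qed.

Definition line z w t : K * K := (z.1 + t * w.1, z.2 + t * w.2).

Lemma line0 z w : line z w 0 = z.
Proof. by case: z => a b; rewrite /line !mul0r !addr0. Qed.

Lemma line1 z w : line z (w.1 - z.1, w.2 - z.2) 1 = w.
Proof. by case: w => a b; rewrite /line !mul1r !(addrC z.1) !(addrC z.2) !subrK. Qed.

(** Being polynomial along every line is all that a density argument needs, and
it only involves polynomials in one variable. *)
Definition poly_on_lines f :=
  forall z w, exists p : {poly K}, forall t, p.[t] = f (line z w t).

Lemma poly_on_linesC c : poly_on_lines (fun=> c).
Proof. by move=> z w; exists c%:P => t; rewrite hornerC. Qed.

Lemma poly_on_linesB f g : poly_on_lines f -> poly_on_lines g ->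
  poly_on_lines (fun z => f z - g z).
Proof.
move=> pf pg z w; have [[p pE] [q qE]] := (pf z w, pg z w).
by exists (p - q) => t; rewrite hornerD hornerN pE qE.
Qed.

Lemma poly_on_linesM f g : poly_on_lines f -> poly_on_lines g ->
  poly_on_lines (fun z => f z * g z).
Proof.
move=> pf pg z w; have [[p pE] [q qE]] := (pf z w, pg z w).
by exists (p * q) => t; rewrite hornerM pE qE.
Qed.

Lemma poly_on_lines_prod (I : Type) (s : seq I) (P : pred I) (f : I -> K * K -> K) :
  (forall i, poly_on_lines (f i)) ->
  poly_on_lines (fun z => \prod_(i <- s | P i) f i z).
Proof.
move=> pf; elim: s => [|i s IH] z w.
  by exists 1 => t; rewrite hornerC big_nil.
have [p pE] := poly_on_linesM (pf i) IH z w; have [q qE] := IH z w.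
by exists (if P i then p else q) => t; rewrite big_cons; case: ifP; rewrite ?pE ?qE.
Qed.

Lemma poly_on_lines_lform p : poly_on_lines (lform p).
Proof.
move=> z w; exists ((lform p z)%:P + lform p w *: 'X) => t.
by rewrite hornerD hornerC hornerZ hornerX /lform /=; ring.
Qed.

(** Join a point where [f] is nonzero to [z] by a line. Along it [f] is a nonzero
polynomial and the product of [f] and [g] vanishes, so [g] vanishes. *)
Lemma poly_on_lines_dense f g : poly_on_lines f -> poly_on_lines g ->
  (exists z, f z != 0) -> (forall z, f z != 0 -> g z = 0) -> forall z, g z = 0.
Proof.
move=> pf pg [z0 fz0] fg z.
have [[p pE] [q qE]] := (pf z0 (z.1 - z0.1, z.2 - z0.2), pg z0 (z.1 - z0.1,
  z.2 - z0.2)).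
have p0 : p != 0.
  apply: contraNN fz0 => /eqP p0.
  by rewrite -(line0 z0 (z.1 - z0.1, z.2 - z0.2)) -pE p0 horner0.
have /eqP : p * q = 0.
  apply: horner_eq0 => t; rewrite hornerM pE qE.
  by have [->|/fg ->] := eqVneq (f (line z0 (z.1 - z0.1, z.2 - z0.2) t)) 0;
    rewrite (mul0r, mulr0).
rewrite mulf_eq0 (negPf p0)/= => /eqP q0.
by rewrite -(line1 z0 z) -qE q0 horner0.
Qed.

Lemma poly_on_lines_prod_neq0 (I : Type) (s : seq I) (P : pred I) (f : I -> K * K ->
  K) :
  (forall i, poly_on_lines (f i)) -> (forall i, P i -> exists z, f i z != 0) ->
  exists z, \prod_(i <- s | P i) f i z != 0.
Proof.
move=> pf f0; elim: s => [|i s [z z0]].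
  by exists 0; rewrite big_nil oner_eq0.
have [Pi|/negPf Pi] := boolP (P i); last by exists z; rewrite big_cons Pi.
have [z' fz'] := f0 _ Pi; apply: contrapT => /forallNP H.
have : forall z, \prod_(i <- s | P i) f i z = 0.
  apply: (poly_on_lines_dense (pf i)); first exact: poly_on_lines_prod.
    by exists z'.
  move=> w fw; apply/eqP/negPn/negP => pw; apply: (H w).
  by rewrite big_cons Pi mulf_neq0.
by move/(_ z)/eqP; rewrite (negPf z0).
Qed.

(** A homogeneous polynomial of degree [n] in two variables, described by its
restrictions to lines: the coefficient of degree [n] on the line through [z] in
the direction [w] is the value at [w]. *)
Definition binary_form n f :=
  forall z w, exists p : {poly K},
    [/\ forall t, p.[t] = f (line z w t), (size p <= n.+1)%N & p`_n = f w].

Lemma binary_formW n f : binary_form n f -> poly_on_lines f.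
Proof. by move=> ff z w; have [p []] := ff z w; exists p. Qed.

Lemma binary_form_comb n a b f g : binary_form n f -> binary_form n g ->
  binary_form n (fun z => f z * a - g z * b).
Proof.
move=> ff fg z w; have [p [pE sp cp]] := ff z w; have [q [qE sq cq]] := fg z w.
exists (a *: p - b *: q); split=> [t||].
- by rewrite hornerD hornerN !hornerZ pE qE; ring.
- rewrite (leq_trans (size_polyD _ _))// geq_max size_polyN.
  by rewrite !(leq_trans (size_scale_leq _ _)).
- by rewrite coefD coefN !coefZ cp cq; ring.
Qed.

Lemma binary_form_prod (I : Type) (s : seq I) (p : I -> K * K) :
  binary_form (size s) (fun z => \prod_(i <- s) lform (p i) z).
Proof.
elim: s => [|i s IH] z w.
  by exists 1; split=> [t||]; rewrite ?hornerC ?size_poly1 ?coef1 ?big_nil.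
have [q [qE sq cq]] := IH z w; have qs : q`_(size s).+1 = 0 by rewrite nth_default.
exists (((lform (p i) z)%:P + lform (p i) w *: 'X) * q); split=> [t||].
- rewrite hornerM qE hornerD hornerC hornerZ hornerX big_cons; congr (_ * _).
  by rewrite /lform /=; ring.
- rewrite (leq_trans (size_polyMleq _ _))//=.
  have : (size ((lform (p i) z)%:P + lform (p i) w *: 'X)%R <= 2)%N.
    rewrite (leq_trans (size_polyD _ _))// geq_max (leq_trans (size_polyC_leq1 _))//.
    by rewrite (leq_trans (size_scale_leq _ _))// size_polyX.
  by move=> sl; have := leq_add sl sq; case: (_ + size q)%N => // k; rewrite add2n ltnS.
- by rewrite mulrDl coefD coefCM /= -scalerAl coefZ coefXM /= qs mulr0 add0r cq
    big_cons.
Qed.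

(** Unless [(1, 0)] is a zero, the restriction to the line of the points [(t, 1)]
has degree exactly [n.+1]. *)
Lemma binary_form_root n f : binary_form n.+1 f -> exists2 z, z != 0 & f z = 0.
Proof.
move=> ff; pose z1 : K * K := (0, 1); pose z0 : K * K := (1, 0).
have [fz0|fz0] := eqVneq (f z0) 0.
  by exists z0 => //; apply/eqP => -[] /eqP; rewrite oner_eq0.
have [p [pE sp cp]] := ff z1 z0.
have /closed_rootP[t /rootP] : size p != 1%N.
  by apply: contraNN fz0 => /eqP sp1; rewrite -cp nth_default// sp1.
rewrite pE => ft; exists (line z1 z0 t) => //.
by apply/eqP => -[_] /eqP; rewrite /= mulr0 addr0 oner_eq0.
Qed.

(** On the line through [z] in the direction [w], the product [E] has as many
distinct roots as its degree, provided that [z] and [w] are independent, and [f]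
vanishes at all of them. So [f] and [E] are proportional there, in the ratio of
their leading coefficients [f w] and [E w]. Density removes the proviso. *)
Lemma binary_form_proportional (I : eqType) (s : seq I) (e : I -> K * K) f :
  let E z := \prod_(i <- s) lform (e i) z in
  s != [::] -> uniq s ->
  {in s &, forall i j, i != j -> wedge (e i) (e j) != 0} ->
  binary_form (size s) f ->
  {in s, forall i z, lform (e i) z = 0 -> f z = 0} ->
  forall z w, f z * E w = f w * E z.
Proof.
move=> E s0 us es ff fe z w;
  have FE : binary_form (size s) E by exact: binary_form_prod.
have [Ew|Ew] := eqVneq (E w) 0.
  move/eqP: (Ew); rewrite prodf_seq_eq0 => /hasP[i si /= /eqP ei].
  by rewrite Ew (fe i si w ei) mulr0 mul0r.
have ew i : i \in s -> lform (e i) w != 0.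
  by move=> si; apply: contraNN Ew => ei; rewrite prodf_seq_eq0; apply/hasP; exists i.
have w0 : exists z', lform (- w.2, w.1) z' != 0.
  case: s s0 ew {us es ff fe FE Ew E} => // i s _ /(_ i (mem_head _ _)) ei.
  have [w2|w2] := eqVneq w.2 0; last by exists (1, 0);
    rewrite /lform /= mulr0 addr0 mulr1 oppr_eq0.
  exists (0, 1); rewrite /lform /= mulr0 add0r mulr1; apply: contraNN ei => /eqP w1.
  by rewrite /lform w1 w2 !mulr0 addr0.
apply/subr0_eq; move: z; apply: (poly_on_lines_dense (poly_on_lines_lform _) _ w0).
  have := binary_form_comb (E w) (f w) ff FE => /binary_formW.
  by under eq_fun do rewrite (mulrC (E _)).
move=> z zw; pose t i := - (lform (e i) z / lform (e i) w).
have [p [pE sp cp]] := binary_form_comb (E w) (f w) ff FE z w.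
suff p0 : p = 0.
  by have := pE 0; rewrite line0 p0 horner0 (mulrC (E _)) => <-.
have eline i u : lform (e i) (line z w u) = lform (e i) z + u * lform (e i) w.
  by rewrite /lform /=; ring.
have rootp : all (root p) (map t s).
  apply/allP => _ /mapP[i si ->].
  have ei0 : lform (e i) (line z w (t i)) = 0 by rewrite eline mulNr divfK ?ew// subrr.
  rewrite rootE pE (fe i si _ ei0) mul0r sub0r oppr_eq0 mulf_eq0; apply/orP; left.
  by rewrite prodf_seq_eq0; apply/hasP; exists i; rewrite //= ei0.
apply/eqP/negPn/negP => p0.
have : (size p <= size s)%N.
  move: sp; rewrite leq_eqVlt => /orP[/eqP sp|]; last by rewrite ltnS.
  move: p0; rewrite -lead_coef_eq0 lead_coefE sp /= cp mulrC subrr.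
  by rewrite eqxx.
have : uniq (map t s).
  rewrite map_inj_in_uniq// => i j si sj /oppr_inj/eqP.
  rewrite eqr_div ?ew// => /eqP ij; apply/eqP/negPn/negP => /(es _ _ si sj).
  have : wedge (e i) (e j) * wedge z w = 0
    by rewrite -wedge_lform ij (mulrC (lform (e j) z)) subrr.
  move/eqP; rewrite mulf_eq0 => /orP[->//|/eqP zw0].
  have zwE : lform (- w.2, w.1) z = - wedge z w by rewrite /lform /wedge /=; ring.
  by move: zw; rewrite zwE zw0 oppr0 eqxx.
move=> ut; have := max_poly_roots p0 rootp ut; rewrite size_map.
by move=> lt1 lt2; have := leq_trans lt1 lt2; rewrite ltnn.
Qed.
End BinaryForms.

Section Pencil.
Variable K : numClosedFieldType.
Implicit Types (z w p : K * K).

Lemma common_kernel p q : wedge p q = 0 ->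
  exists2 z, z != 0 & lform p z = 0 /\ lform q z = 0.
Proof.
have [-> _|p0 pq] := eqVneq p 0.
  have [z z0 qz] := lform_kernel q; exists z => //; split=> //.
  by rewrite /lform /= !mul0r addr0.
exists (p.2, - p.1).
  by apply: contraNN p0; case: p {pq} => a b /eqP[-> /eqP]; rewrite oppr_eq0 => /eqP->.
split; rewrite /lform /=; first by ring.
by transitivity (- wedge p q); [rewrite /wedge; ring|rewrite pq oppr0].
Qed.

Definition lmap (V : (K * K) * (K * K)) z := (lform V.1 z, lform V.2 z).

Variables (I : eqType) (s : seq I) (V : I -> (K * K) * (K * K)).
Variable (B : (K * K) * (K * K)).

(** The quotient of these two forms of degree [size s] is the rational function
that the orbit map induces on the projective line. *)
Definition orbit_form z := (\prod_(i <- s) (lmap (V i) z).1,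
  \prod_(i <- s) (lmap (V i) z).2).

Let e i w := ((V i).1.1 * (lmap B w).2 - (V i).2.1 * (lmap B w).1,
              (V i).1.2 * (lmap B w).2 - (V i).2.2 * (lmap B w).1).

Let lform_e i w z : lform (e i w) z = wedge (lmap (V i) z) (lmap B w).
Proof. by rewrite /e /lform /wedge /lmap /lform /=; ring. Qed.

Let poly_mapB (b : bool) : poly_on_lines (fun w =>
  if b then (lmap B w).1 else (lmap B w).2).
Proof. by case: b; exact: poly_on_lines_lform. Qed.

Lemma orbit_form_wedge_form w :
  binary_form (size s) (fun z => wedge (orbit_form z) (orbit_form w)).
Proof. exact: binary_form_comb (binary_form_prod _ _) (binary_form_prod _ _). Qed.

Lemma poly_on_lines_wedge p (f g : K * K -> K) : poly_on_lines f -> poly_on_lines g ->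
  poly_on_lines (fun w => wedge p (f w, g w)).
Proof.
by move=> pf pg; apply: poly_on_linesB; apply: poly_on_linesM => //;
  exact: poly_on_linesC.
Qed.

(** Here [wedge (lmap (V i) z) (lmap B w) = 0] means that the symmetry [i] moves
the point [z] of the projective line to the point [w]. If [w] has [size s]
distinct preimages, [binary_form_proportional] compares the form
[wedge (orbit_form z) (orbit_form w)] in [z] with the product [E] of the linear
forms that vanish at these preimages. The resulting identity is polynomial in
[w], so it extends to every [w], whatever its stabiliser. Were [E z w] nonzero,
the identity would make all values of [orbit_form] proportional to the one at
[w], which the zeros of a single factor exclude. *)
Lemma orbit_form_fibre z w :
  s != [::] -> uniq s ->
  {in s &, forall i j, i != j -> exists w, forall z, z != 0 ->
     wedge (lmap (V i) z) (lmap B w) = 0 -> wedge (lmap (V j) z) (lmap B w) != 0} ->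
  {in s, forall i z w, wedge (lmap (V i) z) (lmap B w) = 0 ->
     wedge (orbit_form z) (orbit_form w) = 0} ->
  (forall w, w != 0 -> orbit_form w != 0) ->
  w != 0 -> wedge (orbit_form z) (orbit_form w) = 0 ->
  exists2 i, i \in s & wedge (lmap (V i) z) (lmap B w) = 0.
Proof.
move=> s0 us sep inv orbit_form0 w0 zw.
pose E z w := \prod_(i <- s) wedge (lmap (V i) z) (lmap B w).
have cross z1 z2 w1 : wedge (orbit_form z1) (orbit_form w1) * E z2 w1 =
  wedge (orbit_form z2) (orbit_form w1) * E z1 w1.
  pose pairs := [seq (i, j) | i <- s, j <- s].
  pose P ij := [&& ij.1 \in s, ij.2 \in s & ij.1 != ij.2].
  (* Nonzero at the points w that have [size s] distinct preimages. *)
  pose g w := \prod_(ij <- pairs | P ij) wedge (e ij.1 w) (e ij.2 w).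
  have pe i : poly_on_lines (fun w => (e i w).1) /\ poly_on_lines (fun w => (e i w).2).
    by split; apply: poly_on_linesB; apply: poly_on_linesM; try exact: poly_on_linesC;
      [exact: (poly_mapB false)|exact: (poly_mapB true)|exact: (poly_mapB
        false)|exact: (poly_mapB true)].
  have pw ij : poly_on_lines (fun w => wedge (e ij.1 w) (e ij.2 w)).
    have [p1 p2] := pe ij.1; have [q1 q2] := pe ij.2.
    by apply: poly_on_linesB; exact: poly_on_linesM.
  have g0 : exists w, g w != 0.
    apply: poly_on_lines_prod_neq0 => // -[i j] /and3P[/= si sj ij].
    have [w' sw'] := sep i j si sj ij; exists w'; apply/eqP => /common_kernel[z' z'0].
    by rewrite !lform_e => -[/(sw' _ z'0)/eqP].
  have pE z' : poly_on_lines (E z').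
    by apply: poly_on_lines_prod => i; apply: poly_on_lines_wedge;
      exact: poly_on_lines_lform.
  have pD z' : poly_on_lines (fun w => wedge (orbit_form z') (orbit_form w)).
    by apply: poly_on_lines_wedge; apply: poly_on_lines_prod => i;
      exact: poly_on_lines_lform.
  apply/subr0_eq; move: w1; apply: (poly_on_lines_dense _ _ g0).
  - exact: poly_on_lines_prod.
  - by apply: poly_on_linesB; apply: poly_on_linesM.
  move=> w1; rewrite prodf_seq_neq0 => /allP gw; apply/eqP; rewrite subr_eq0; apply/eqP.
  have := @binary_form_proportional K I s (e^~ w1) (fun z => wedge (orbit_form z)
    (orbit_form w1)) s0 us.
  move=> /(_ _ (orbit_form_wedge_form w1) _ z1 z2).
  under [X in _ * X]eq_bigr do rewrite lform_e.
  under [X in _ = _ * X]eq_bigr do rewrite lform_e.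
  apply.
  - move=> i j si sj ij; have := gw (i, j); rewrite allpairs_f// => /(_ isT).
    by rewrite /P /= si sj ij.
  - by move=> i si z'; rewrite lform_e; exact: inv.
have [Ez|Ez] := eqVneq (E z w) 0.
  by move/eqP: Ez; rewrite prodf_seq_eq0 => /hasP[i si /= /eqP ?]; exists i.
have {}cross z' : wedge (orbit_form z') (orbit_form w) = 0.
  by apply: (mulIf Ez); rewrite -cross zw !mul0r.
(* Each coordinate of [orbit_form] vanishes at some point; comparing these two
   points with w makes both coordinates vanish at w. *)
have [i si] : exists i, i \in s by case: (s) s0 => // i s' _; exists i; exact: mem_head.
have [z1 z10 z1i] := lform_kernel (V i).1; have [z2 z20 z2i] := lform_kernel (V i).2.
have F1 : (orbit_form z1).1 = 0.
  by apply/eqP; rewrite prodf_seq_eq0; apply/hasP; exists i; rewrite //= z1i.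
have F2 : (orbit_form z2).2 = 0.
  by apply/eqP; rewrite prodf_seq_eq0; apply/hasP; exists i; rewrite //= z2i.
have := orbit_form0 _ w0; have := orbit_form0 _ z10; have := orbit_form0 _ z20;
  have := cross z1; have := cross z2.
rewrite /wedge F1 F2 mul0r mul0r subr0 sub0r.
move: F1 F2; case: (orbit_form z1) => a1 a2; case: (orbit_form z2) => b1 b2;
  case: (orbit_form w) => c1 c2 /= -> ->.
move=> /eqP; rewrite mulf_eq0 => /orP[/eqP ->|/eqP ->]; first by rewrite eqxx.
move=> /eqP; rewrite oppr_eq0 mulf_eq0 => /orP[/eqP ->|/eqP ->]; first by rewrite eqxx.
by rewrite eqxx.
Qed.
End Pencil.

(** * Spinors and the Hopf map *)

Section Spinors.
Variable R : realType.
Local Notation C := (complex R).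
Local Notation Re := (@complex.Re R).
Local Notation Im := (@complex.Im R).
Local Notation is_rot := (@SO_set R 3).
Implicit Types (z w : C * C) (x y : C) (v : 'cV[R]_3).

Definition abs2 x : R := Re x ^+ 2 + Im x ^+ 2.

Lemma abs2_ge0 x : 0 <= abs2 x. Proof. by rewrite addr_ge0 ?sqr_ge0. Qed.
Lemma abs2_eq0 x : (abs2 x == 0) = (x == 0).
Proof. by case: x => a b; rewrite paddr_eq0 ?sqr_ge0// !sqrf_eq0 eq_complex. Qed.
Lemma abs2M x y : abs2 (x * y) = abs2 x * abs2 y.
Proof. by case: x y => [a b] [c d]; rewrite /abs2 /=; ring. Qed.
Lemma abs21 : abs2 1 = 1. Proof. by rewrite /abs2 /=; ring. Qed.

Definition norm2 z := abs2 z.1 + abs2 z.2.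
(** Normalised so that the vector has length [norm2 z]. *)
Definition hopf z : 'cV[R]_3 :=
  vec3 (2 * Re (conjc z.1 * z.2)) (2 * Im (conjc z.1 * z.2)) (abs2 z.1 - abs2 z.2).

Lemma norm2_ge0 z : 0 <= norm2 z. Proof. by rewrite addr_ge0 ?abs2_ge0. Qed.
Lemma norm2_eq0 z : (norm2 z == 0) = (z == 0).
Proof. by case: z => x y; rewrite paddr_eq0 ?abs2_ge0// !abs2_eq0. Qed.

(** Every link between spinors and directions in space comes from this identity,
through [sqn_hopf] and [hopf_colinear]. *)
Lemma dot_hopf z w : dot (hopf z) (hopf w) = norm2 z * norm2 w - 2 * abs2 (wedge z w).
Proof.
case: z w => [[a b] [c d]] [[a' b'] [c' d']].
by rewrite /dot /hopf !vec3E /norm2 /wedge /abs2 /=; ring.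
Qed.

Lemma sqn_hopf z : sqn (hopf z) = norm2 z ^+ 2.
Proof. by rewrite /sqn dot_hopf wedgezz /abs2 /=; ring. Qed.

Lemma sqn_ge0 (v : 'cV[R]_3) : 0 <= sqn v.
Proof. by rewrite /sqn /dot -!expr2 !addr_ge0 ?sqr_ge0. Qed.

Lemma sqn_eq0 (v : 'cV[R]_3) : sqn v = 0 -> v = 0.
Proof.
move/eqP; rewrite /sqn /dot -!expr2 !paddr_eq0 ?addr_ge0 ?sqr_ge0// !sqrf_eq0.
by move=> /andP[/andP[/eqP ? /eqP ?] /eqP ?]; apply: vec3P; rewrite mxE.
Qed.

Definition len (v : 'cV[R]_3) := Num.sqrt (sqn v).

Lemma len_ge0 v : 0 <= len v. Proof. exact: sqrtr_ge0. Qed.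
Lemma sqr_len v : len v ^+ 2 = sqn v. Proof. by rewrite sqr_sqrtr ?sqn_ge0. Qed.
Lemma len_eq0 v : (len v == 0) = (v == 0).
Proof.
apply/eqP/eqP => [l0|->]; first by apply: sqn_eq0; rewrite -sqr_len l0 expr0n.
by rewrite /len /sqn /dot !mxE !mulr0 !addr0 sqrtr0.
Qed.
Lemma len0 : len (0 : 'cV[R]_3) = 0. Proof. by apply/eqP; rewrite len_eq0. Qed.
Lemma lenZ (k : R) v : 0 <= k -> len (k *: v) = k * len v.
Proof.
move=> k0; rewrite /len (_ : sqn (k *: v) = k ^+ 2 * sqn v);
  last by rewrite /sqn /dot !mxE; ring.
by rewrite sqrtrM ?sqr_ge0// sqrtr_sqr ger0_norm.
Qed.
Lemma lenN v : len (- v) = len v.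
Proof. by rewrite /len (_ : sqn (- v) = sqn v)// /sqn /dot !mxE; ring. Qed.
Lemma rot_len (M : 'M[R]_3) v : is_rot M -> len (M *m v) = len v.
Proof. by move=> rM; rewrite /len rot_sqn. Qed.

Lemma len_hopf z : len (hopf z) = norm2 z.
Proof. by rewrite /len sqn_hopf sqrtr_sqr ger0_norm ?norm2_ge0. Qed.

Lemma hopf_surj v : exists z, hopf z = v.
Proof.
have len2 : len v ^+ 2 = v 0 0 ^+ 2 + v 1 0 ^+ 2 + v 2 0 ^+ 2.
  by rewrite sqr_sqrtr ?sqn_ge0.
have l0 : 0 <= len v by rewrite sqrtr_ge0.
have K x y : 2 * Re (conjc x * y) = v 0 0 -> 2 * Im (conjc x * y) = v 1 0 ->
    abs2 x - abs2 y = v 2 0 -> exists z, hopf z = v.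
  by move=> E0 E1 E2; exists (x, y); apply: vec3P; rewrite /hopf !vec3E.
move: K.
move: (len v) (v 0 0) (v 1 0) (v 2 0) len2 l0 => r a b c r2 r0 K.
have rc0 : 0 <= r + c.
  have : `|c| <= r by rewrite -(ler_pXn2r (_ : 0 < 2)%N) ?nnegrE// real_normK
    ?num_real// r2; nra.
  by rewrite ler_norml => /andP[+ _]; lra.
(* In this case the vector is on the negative third axis. *)
have [rc|rc] := eqVneq (r + c) 0.
  have [a0 b0] : a = 0 /\ b = 0.
    have : a ^+ 2 + b ^+ 2 = 0 by nra.
    by move/eqP; rewrite paddr_eq0 ?sqr_ge0// !sqrf_eq0 => /andP[/eqP ? /eqP ?].
  by apply: (K 0 (Complex (Num.sqrt r) 0)); rewrite /abs2 /= ?sqr_sqrtr//; lra.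
have s0 : 0 < (r + c) / 2 by rewrite divr_gt0// lt_def rc.
have := sqr_sqrtr (ltW s0);
  have : Num.sqrt ((r + c) / 2) != 0 by rewrite gt_eqF ?sqrtr_gt0.
move: (Num.sqrt _) => s sn0 s2.
apply: (K (Complex s 0) (Complex (a / (2 * s)) (b / (2 * s)))); rewrite /abs2 /=.
- by field.
- by field.
- have -> : s ^+ 2 + 0 ^+ 2 - ((a / (2 * s)) ^+ 2 + (b / (2 * s)) ^+ 2) = 
  s ^+ 2 - (a ^+ 2 + b ^+ 2) / (4 * s ^+ 2) by field.
  rewrite s2 (_ : a ^+ 2 + b ^+ 2 = r ^+ 2 - c ^+ 2); last by rewrite r2; ring.
  by field.
Qed.

Lemma hopf_colinear z w : wedge z w = 0 <-> norm2 w *: hopf z = norm2 z *: hopf w.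
Proof.
split=> [zw|/(congr1 (dot (hopf w)))].
  apply/subr0_eq/sqn_eq0.
  transitivity (norm2 w ^+ 2 * dot (hopf z) (hopf z) + norm2 z ^+ 2 * dot (hopf w)
    (hopf w) -
     2 * norm2 z * norm2 w * dot (hopf z) (hopf w)).
    by rewrite /sqn /dot !mxE; ring.
  by rewrite !dot_hopf zw !wedgezz /abs2 /=; ring.
have dZ k u v : dot u (k *: v) = k * dot u v :> R by rewrite /dot !mxE; ring.
rewrite !dZ !dot_hopf wedgezz => H.
have wz : abs2 (wedge w z) = abs2 (wedge z w).
  rewrite (_ : wedge w z = (-1) * wedge z w) ?abs2M /wedge; last by ring.
  by rewrite /abs2 /=; ring.
have [w0|w0] := eqVneq (norm2 w) 0.
  by move/eqP: w0; rewrite norm2_eq0 => /eqP ->; rewrite /wedge /=; ring.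
apply/eqP; rewrite -abs2_eq0 -wz; apply/eqP.
have s0: abs2 0 = 0 by rewrite /abs2 /=; ring.
rewrite s0 in H.
by apply: (mulfI w0); lra.
Qed.

(** The lift of [rodrigues t v] is the matrix [t - i (v . sigma)] of SU(2), where
[sigma] is the vector of the Pauli matrices. *)
Lemma spin_lift A : is_rot A ->
  {V : (C * C) * (C * C) | forall z, hopf (lmap V z) = A *m hopf z}.
Proof.
move=> rA; apply/cid; have [t [v [tv <-]]] := rodrigues_surj rA.
exists ((Complex t (- v 2 0), Complex (- v 1 0) (- v 0 0)),
   (Complex (v 1 0) (- v 0 0), Complex t (v 2 0))) => -[[a b] [c d]].
rewrite rodrigues_mul; apply: vec3P;
rewrite /hopf !mxE /= ?vec3E /sqn /dot ?vec3E /abs2 /lmap /lform /=; ring.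
Qed.
End Spinors.

(** * The orbit map of a finite set of rotations *)

Section OrbitMap.
Variable R : realType.
Local Notation C := (complex R).
Local Notation Re := (@complex.Re R).
Local Notation Im := (@complex.Im R).
Local Notation is_rot := (@SO_set R 3).
Implicit Types (z w : C * C) (v : 'cV[R]_3) (M c : 'M[R]_3) (L : seq 'M[R]_3).

Definition north_prod L v := \prod_(M <- L) (len v + (M *m v) 2 0).
Definition south_prod L v := \prod_(M <- L) (len v - (M *m v) 2 0).
Definition equator_prod L v : C := \prod_(M <- L) Complex ((M *m v) 0 0) ((M *m v) 1 0).
(** By [orbit_map_hopf], this is the pair of forms [orbit_form] seen through the
Hopf map. Writing it in terms of the vector shows that it is continuous and
makes its parity visible. The quotient by [north_prod + south_prod] makes it
homogeneous of degree one. *)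
Definition orbit_map L v := (len v / (north_prod L v + south_prod L v)) *:
  vec3 (2 * Re (equator_prod L v)) (2 * Im (equator_prod L v))
       (north_prod L v - south_prod L v).

Lemma orbit_map0 L : orbit_map L 0 = 0.
Proof. by rewrite /orbit_map len0 mul0r scale0r. Qed.

Lemma orbit_map_invariant L g v : is_rot g -> perm_eq [seq M *m g | M <- L] L ->
  orbit_map L (g *m v) = orbit_map L v.
Proof.
move=> rg Lg; have E (T : comNzRingType) (f : 'cV[R]_3 -> T) :
    \prod_(M <- L) f (M *m (g *m v)) = \prod_(M <- L) f (M *m v).
  rewrite -[RHS](perm_big _ Lg) big_map; apply: eq_bigr => M _; by rewrite mulmxA.
rewrite /orbit_map /north_prod /south_prod /equator_prod rot_len//.
rewrite (E R (fun u => len v + u 2 0)) (E R (fun u => len v - u 2 0)).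
by rewrite (E C (fun u => Complex (u 0 0) (u 1 0))).
Qed.

Lemma prodZ (T : comNzRingType) L (k : T) (f : 'M[R]_3 -> T) :
  \prod_(M <- L) (k * f M) = k ^+ size L * \prod_(M <- L) f M.
Proof.
by elim: L => [|M L IH]; rewrite ?big_nil ?mulr1// !big_cons IH /= exprS; ring.
Qed.

Lemma Re_realM (k : R) (x : C) : Re (k%:C%C * x) = k * Re x.
Proof. by case: x => a b /=; ring. Qed.
Lemma Im_realM (k : R) (x : C) : Im (k%:C%C * x) = k * Im x.
Proof. by case: x => a b /=; ring. Qed.

Lemma orbit_mapZ L (k : R) v : 0 <= k -> orbit_map L (k *: v) = k *: orbit_map L v.
Proof.
move=> k0; have [->|kn0] := eqVneq k 0; first by rewrite !scale0r orbit_map0.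
have pE : north_prod L (k *: v) = k ^+ size L * north_prod L v.
  by rewrite -prodZ; apply: eq_bigr => M _; rewrite lenZ// -scalemxAr mxE mulrDr.
have nE : south_prod L (k *: v) = k ^+ size L * south_prod L v.
  by rewrite -prodZ; apply: eq_bigr => M _; rewrite lenZ// -scalemxAr mxE mulrBr.
have eE : equator_prod L (k *: v) = (k ^+ size L)%:C%C * equator_prod L v.
  rewrite rmorphXn -prodZ; apply: eq_bigr => M _; rewrite -scalemxAr !mxE.
  by apply/eqP; rewrite eq_complex /= !mul0r subr0 addr0 !eqxx.
rewrite /orbit_map lenZ// pE nE eE Re_realM Im_realM -mulrDr -mulrBr.
have kn : k ^+ size L != 0 by rewrite expf_neq0.
move: (k ^+ size L) kn => m m0; rewrite invfM; move: (_ + _)^-1 => q.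
by apply: vec3P; rewrite !mxE /=; field.
Qed.

Lemma north_prodN L v : north_prod L (- v) = south_prod L v.
Proof. by apply: eq_bigr => M _; rewrite lenN mulmxN mxE. Qed.

Lemma south_prodN L v : south_prod L (- v) = north_prod L v.
Proof. by apply: eq_bigr => M _; rewrite lenN mulmxN mxE opprK. Qed.

Lemma equator_prodN L v : equator_prod L (- v) = (-1) ^+ size L * equator_prod L v.
Proof.
rewrite -prodZ; apply: eq_bigr => M _; rewrite mulmxN !mxE.
by apply/eqP; rewrite mulN1r eq_complex /= !eqxx.
Qed.

(** Negation exchanges the two polar products and changes the sign of every factor
of the equatorial one. *)
Lemma orbit_mapN_odd L v : odd (size L) -> orbit_map L (- v) = - orbit_map L v.
Proof.
move=> oL; rewrite /orbit_map equator_prodN lenN -signr_odd oL expr1 mulN1r.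
rewrite north_prodN south_prodN (addrC (south_prod _ _)).
by case: (equator_prod L v) => a b; apply: vec3P; rewrite !mxE /=; ring.
Qed.

Lemma orbit_mapN_even L v : ~~ odd (size L) ->
  orbit_map L (- v) = vec3 (orbit_map L v 0 0) (orbit_map L v 1 0) (- orbit_map L v 2
    0).
Proof.
move=> oL; rewrite /orbit_map equator_prodN lenN -signr_odd (negPf oL) expr0 mul1r.
rewrite north_prodN south_prodN (addrC (south_prod _ _)).
by apply: vec3P; rewrite !mxE /=; ring.
Qed.

Variables (L : seq 'M[R]_3) (c : 'M[R]_3).
Hypothesis Lrot : {in L, forall M, is_rot M}.
Hypothesis c_rot : is_rot c.
(** In terms of spinors: the two coordinates of [orbit_form] have no common zero. *)
Hypothesis nondeg : forall v, v != 0 -> north_prod L v + south_prod L v != 0.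

Let V M : (C * C) * (C * C) :=
  if pselect (is_rot M) is left rM then sval (spin_lift rM) else ((0, 0), (0, 0)).
Let hopfV M z : is_rot M -> hopf (lmap (V M) z) = M *m hopf z.
Proof. by rewrite /V; case: pselect => // rM _; exact: (svalP (spin_lift rM)). Qed.
Let nrmV M z : is_rot M -> norm2 (lmap (V M) z) = norm2 z.
Proof. by move=> rM; rewrite -!len_hopf hopfV// rot_len. Qed.

Local Notation F := (orbit_form L V).

Lemma north_prod_hopf z : north_prod L (hopf z) = 2 ^+ size L * abs2 (F z).1.
Proof.
have -> : abs2 (F z).1 = \prod_(M <- L) abs2 (lmap (V M) z).1.
  rewrite /orbit_form /=; elim: (L) => [|M L' IH]; rewrite ?big_nil ?abs21// !big_cons.
  by rewrite abs2M IH.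
rewrite -prodZ; apply: eq_big_seq => M /Lrot rM.
by rewrite -hopfV// len_hopf -(nrmV z rM) vec3E /norm2; ring.
Qed.

Lemma south_prod_hopf z : south_prod L (hopf z) = 2 ^+ size L * abs2 (F z).2.
Proof.
have -> : abs2 (F z).2 = \prod_(M <- L) abs2 (lmap (V M) z).2.
  rewrite /orbit_form /=; elim: (L) => [|M L' IH]; rewrite ?big_nil ?abs21// !big_cons.
  by rewrite abs2M IH.
rewrite -prodZ; apply: eq_big_seq => M /Lrot rM.
by rewrite -hopfV// len_hopf -(nrmV z rM) vec3E /norm2; ring.
Qed.

Lemma equator_prod_hopf z : equator_prod L (hopf z) =
  (2 ^+ size L)%:C%C * (conjc (F z).1 * (F z).2).
Proof.
rewrite /= rmorph_prod -big_split rmorphXn -prodZ; apply: eq_big_seq => M /Lrot rM.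
by rewrite -hopfV// !vec3E; apply/eqP; rewrite eq_complex /= Re_realM Im_realM !eqxx.
Qed.

(** If [l] and [m] are the coordinates of the lift of [M] at [z], the factors of
the three products for [M] are [2 |l|^2], [2 |m|^2] and [2 conj(l) m].
Surjectivity and the description of the fibres become questions on forms. *)
Lemma orbit_map_hopf z : orbit_map L (hopf z) = (norm2 z / norm2 (F z)) *: hopf (F z).
Proof.
rewrite /orbit_map len_hopf equator_prod_hopf north_prod_hopf south_prod_hopf
  Re_realM Im_realM -mulrDr -mulrBr.
have kn : 2 ^+ size L != 0 :> R by rewrite expf_neq0// pnatr_eq0.
rewrite -/(norm2 (F z)) invfM; move: (2 ^+ size L) (norm2 (F z))^-1 kn => m q m0.
by apply: vec3P; rewrite !mxE /=; field.
Qed.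

Lemma orbit_form_neq0 z : z != 0 -> F z != 0.
Proof.
move=> z0; rewrite -norm2_eq0;
  have /nondeg : hopf z != 0 by rewrite -len_eq0 len_hopf norm2_eq0.
by apply: contraNN => /eqP F0;
  rewrite north_prod_hopf south_prod_hopf -mulrDr -/(norm2 (F z)) F0 mulr0.
Qed.

(** This makes the suspension [orbit_sphere_map] land on the 3-sphere. *)
Lemma sqn_orbit_map v : sqn (orbit_map L v) = sqn v.
Proof.
have [z <-] := hopf_surj v; have [->|z0] := eqVneq z 0.
  have -> : hopf (0 : C * C) = 0 by apply/eqP; rewrite -len_eq0 len_hopf norm2_eq0.
  by rewrite orbit_map0.
have := orbit_form_neq0 z0; rewrite -norm2_eq0 => Fz0.
have sqnZ k u : sqn (k *: u) = k ^+ 2 * sqn u :> R by rewrite /sqn /dot !mxE; ring.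
by rewrite orbit_map_hopf sqnZ !sqn_hopf; field.
Qed.

Lemma len_orbit_map v : len (orbit_map L v) = len v.
Proof. by rewrite /len sqn_orbit_map. Qed.

Lemma wedge_lift M z w : is_rot M ->
  wedge (lmap (V M) z) (lmap (V c) w) = 0 <->
    norm2 w *: (M *m hopf z) = norm2 z *: (c *m hopf w).
Proof. by move=> rM; rewrite hopf_colinear !nrmV// !hopfV. Qed.

(** A zero [z] of the form [wedge (orbit_form z) w] yields a vector mapped to a
positive multiple of [hopf w]. *)
Lemma orbit_map_surj y : L != [::] -> exists v, orbit_map L v = y.
Proof.
move=> L0; have [->|y0] := eqVneq y 0; first by exists 0; exact: orbit_map0.
have [w wy] := hopf_surj y; move: y0; rewrite -wy -len_eq0 len_hopf => w0.
have [z z0] : exists2 z, z != 0 & wedge (F z) w = 0.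
  apply: (@binary_form_root _ (size L).-1); rewrite prednK ?lt0n ?size_eq0//.
  exact: binary_form_comb (binary_form_prod _ _) (binary_form_prod _ _).
rewrite hopf_colinear => Fzw; exists ((norm2 w / norm2 z) *: hopf z).
have := orbit_form_neq0 z0; move: z0; rewrite -!norm2_eq0 => z0 F0.
rewrite orbit_mapZ ?divr_ge0 ?norm2_ge0// orbit_map_hopf scalerA.
rewrite (_ : _ * _ = (norm2 (F z))^-1 * norm2 w); last by field; rewrite z0 F0.
by rewrite -scalerA Fzw scalerA mulVf// scale1r.
Qed.

Hypothesis inv : {in L, forall M v, orbit_map L (c^T *m (M *m v)) = orbit_map L v}.

(** The transcription of [orbit_form_fibre]. Two rotations that agree on all
vectors are equal, which provides the points that distinct symmetries separate;
the invariance of [orbit_form] is that of [orbit_map]. *)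
Lemma orbit_map_fibre v v' : L != [::] -> uniq L -> orbit_map L v = orbit_map L v' ->
  exists2 M, M \in L & c^T *m (M *m v) = v'.
Proof.
move=> L0 uL vv'; have [[z zv] [w wv]] := (hopf_surj v, hopf_surj v').
have nzw : norm2 z = norm2 w
  by rewrite -!len_hopf zv wv -len_orbit_map vv' len_orbit_map.
have [i iL] : exists M, M \in L by case: (L) L0 => // M L' _; exists M; exact: mem_head.
have ctc := rot_trmxK c_rot.
have [w0|w0] := eqVneq w 0.
  have n0 : norm2 w = 0 by apply/eqP; rewrite norm2_eq0 w0.
  exists i => //; have -> : v = 0 by apply/eqP; rewrite -len_eq0 -zv len_hopf nzw n0.
  have -> : v' = 0 by apply/eqP; rewrite -len_eq0 -wv len_hopf n0.
  by rewrite !mulmx0.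
have z0 : z != 0 by rewrite -norm2_eq0 nzw norm2_eq0.
have nz0 : norm2 z != 0 by rewrite norm2_eq0.
have nw0 : norm2 w != 0 by rewrite norm2_eq0.
have wedge0 z1 w1 : z1 != 0 -> w1 != 0 ->
    norm2 w1 *: orbit_map L (hopf z1) = norm2 z1 *: orbit_map L (hopf w1) ->
      wedge (F z1) (F w1) = 0.
  move=> z10 w10; have := orbit_form_neq0 z10; have := orbit_form_neq0 w10.
  move: z10 w10; rewrite -!norm2_eq0 => z10 w10 Fw Fz.
  rewrite !orbit_map_hopf !scalerA hopf_colinear => H.
  have := congr1 (fun u => ((norm2 (F z1) * norm2 (F w1)) / (norm2 z1 * norm2 w1)) *:
    u) H.
  rewrite !scalerA.
  rewrite (_ : _ * _ = norm2 (F w1)); last by field; rewrite z10 w10 Fz.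
  by rewrite (_ : _ * _ = norm2 (F z1)) => [//|]; field; rewrite z10 w10 Fw.
have F0 : F 0 = 0.
  have lform0 p : lform p 0 = 0 :> C.
    by rewrite (_ : 0 = (0, 0))// /lform /= !mulr0 addr0.
  by congr pair; apply/eqP; rewrite prodf_seq_eq0; apply/hasP; exists i => //=;
    exact/eqP/lform0.
have [||||M ML] := @orbit_form_fibre _ _ L V (V c) z w L0 uL _ _ _ w0.
- move=> M N ML NL MN.
  have [u Mu] : exists u : 'cV[R]_3, M^T *m u <> N^T *m u.
    apply/existsNP => H; move/eqP: MN; apply; apply: trmx_inj; exact: eq_mulmx_cV.
  have [w' w'u] := hopf_surj (c^T *m u); have cw' : c *m hopf w' = u.
    by rewrite w'u mulmxA; have [-> _] := c_rot; rewrite mul1mx.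
  exists w' => z'; rewrite -norm2_eq0 => z'0 /wedge_lift => /(_ (Lrot ML)) EM.
  apply/eqP => /wedge_lift => /(_ (Lrot NL)) EN; apply: Mu.
  have tK (A : 'M[R]_3) : is_rot A ->
    norm2 w' *: (A *m hopf z') = norm2 z' *: (c *m hopf w') ->
     A^T *m u = (norm2 w' / norm2 z') *: hopf z'.
    move=> rA /(congr1 (fun x => (norm2 z')^-1 *: (A^T *m x))).
    rewrite -!scalemxAr !scalerA mulVf// scale1r cw' => <-.
    by rewrite mulmxA rot_trmxK// mul1mx mulrC.
  by rewrite (tK M)// ?(tK N)//; exact: Lrot.
- move=> M ML z1 w1 /wedge_lift => /(_ (Lrot ML)) E.
  have [->|z10] := eqVneq z1 0.
    by rewrite F0 /wedge /= !mul0r subrr.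
  have [->|w10] := eqVneq w1 0.
    by rewrite F0 /wedge /= !mulr0 subrr.
  apply: wedge0 => //; rewrite -!orbit_mapZ ?norm2_ge0// -(inv ML (_ *: _)).
  by rewrite -scalemxAr E -scalemxAr mulmxA ctc mul1mx.
- exact: orbit_form_neq0.
- by apply: wedge0 => //; rewrite zv wv vv' nzw.
move=> /wedge_lift => /(_ (Lrot ML)); rewrite nzw => /(scalerI nw0) E.
by exists M => //; rewrite -zv E mulmxA ctc mul1mx.
Qed.
End OrbitMap.

(** * Frames in general position *)

Section Generic.
Variable R : realType.
Local Notation is_rot := (@SO_set R 3).
Implicit Types (v : 'cV[R]_3) (s : seq 'M[R]_3).

Lemma rot_neqN1 (g : 'M[R]_3) : is_rot g -> g != - 1%:M.
Proof.
case=> _; apply: contra_eqN => /eqP ->.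
by rewrite det_mx33 !mxE /=; apply/eqP => H; lra.
Qed.

(** A vector reversed by [g] is in the kernel of [g + 1], a proper subspace since
the determinant of [g] is not that of -1. The curve [(1, t, t^2)] meets a proper
subspace finitely many times. *)
Lemma generic_direction s : {in s, forall g, is_rot g} ->
  exists2 a, sqn a = 1 & {in s, forall g, g *m a != - a}.
Proof.
move=> rs.
have /choice[p pP] : forall g : 'M[R]_3, exists q : {poly R}, is_rot g -> q != 0 /\
    forall t : R, q.[t] != 0 -> g *m vec3 1 t (t ^+ 2) != - vec3 1 t (t ^+ 2).
  move=> g.
  have [rg|] := pselect (is_rot g); last by exists 0.
  have := rot_neqN1 rg; rewrite -addr_eq0.
  case/matrix0Pn => i [j gij].
  exists (Poly [:: (g + 1%:M) i 0; (g + 1%:M) i 1; (g + 1%:M) i 2]) => _; split.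
    apply: contraNN gij => /eqP/polyP q0.
    have := (q0 0%N, q0 1%N, q0 2%N); rewrite !coef_Poly !coef0 /= => -[[e0 e1] e2].
    by apply/eqP; exact: (@forall_I3 (fun j => (g + 1%:M) i j = 0) e0 e1 e2).
  move=> t; apply: contraNN => /eqP ga; apply/eqP.
  have : ((g + 1%:M) *m vec3 1 t (t ^+ 2)) i 0 = 0
    by rewrite mulmxDl mul1mx ga addNr mxE.
  by rewrite mulmx_vec3 !vec3E => E; rewrite horner_Poly /= -[RHS]E; ring.
pose q := \prod_(g <- s) p g.
have q0 : q != 0 by rewrite prodf_seq_neq0; apply/allP => g /rs /pP[].
have [t qt] : exists t, q.[t] != 0.
  apply: contrapT => /forallNP H; move/eqP: q0; apply; apply: horner_eq0 => t.
  by apply/eqP/negPn/negP/H.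
pose a := vec3 1 t (t ^+ 2).
have a0 : len a != 0.
  by rewrite len_eq0; apply/eqP => /matrixP/(_ 0 0); rewrite vec3E mxE => /eqP;
    rewrite oner_eq0.
exists ((len a)^-1 *: a).
  rewrite (_ : sqn _ = (len a) ^- 2 * sqn a); last by rewrite /sqn /dot !mxE -exprVn;
    ring.
  by rewrite -sqr_len mulVf// expf_neq0.
move=> g sg; have [_ /(_ t)] := pP g (rs _ sg).
move: qt; rewrite horner_prod prodf_seq_neq0 => /allP/(_ _ sg) /= => -> /(_ isT).
rewrite -scalemxAr -scalerN; apply: contraNN => /eqP.
by move/(scalerI (invr_neq0 a0)) => /eqP.
Qed.

(** If [a = hopf z], it suffices that the first row of the lift be the conjugate
of [z], for then the lift sends [z] to [(1, 0)]. *)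
Lemma rot_to_pole a : sqn a = 1 -> exists2 c, is_rot c & c *m a = vec3 0 0 1.
Proof.
have [[[x y] [x' y']] <-] := hopf_surj a; rewrite sqn_hopf => n1.
have {}n1 : norm2 (Complex x y, Complex x' y') = 1.
  by apply/eqP; rewrite -(@eqrXn2 _ 2)// ?norm2_ge0// n1 expr1n.
pose v := vec3 y' (- x') y.
have tv : x * x + sqn v = 1 by rewrite -n1 /sqn /dot !vec3E /norm2 /abs2 /=; ring.
exists (rodrigues x v); first exact: rodrigues_rot.
have -> : rodrigues x v *m hopf (Complex x y, Complex x' y') =
    vec3 0 0 (norm2 (Complex x y, Complex x' y') ^+ 2).
  rewrite rodrigues_mul; apply: vec3P;
  by rewrite /hopf !mxE /= /norm2 /sqn /dot /abs2 ?vec3E /=; ring.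
by rewrite n1 expr1n.
Qed.

(** If both products vanished at [v], two elements [g] and [h] would send [v] to
opposite multiples of the vector [a] that [c] sends to the third axis, and
[g h^-1] would reverse [a]. *)
Lemma generic_frame s : {in s, forall g, is_rot g} ->
  {in s &, forall g h, g *m h^T \in s} ->
  exists2 c, is_rot c &
    forall v, v != 0 ->
      north_prod [seq c *m g | g <- s] v + south_prod [seq c *m g | g <- s] v != 0.
Proof.
move=> rs Gs; have [a a1 ga] := generic_direction rs.
have [c rc ca] := rot_to_pole a1; exists c => // v v0.
have cgv g : g \in s -> len (c *m g *m v) = len v.
  by move=> gs; rewrite -mulmxA !rot_len//; exact: rs.
have le_len (u : 'cV[R]_3) : `|u 2 0| <= len u.
  rewrite -(ler_pXn2r (_ : 0 < 2)%N)// ?nnegrE ?len_ge0//.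
  rewrite real_normK ?num_real// sqr_len /sqn /dot.
  by rewrite -!expr2 lerDr addr_ge0 ?sqr_ge0.
have Pge0 : 0 <= north_prod [seq c *m g | g <- s] v.
  rewrite /north_prod big_map big_seq; apply: prodr_ge0 => g gs.
  by have := le_len (c *m g *m v); rewrite cgv// ler_norml => /andP[]; lra.
have Nge0 : 0 <= south_prod [seq c *m g | g <- s] v.
  rewrite /south_prod big_map big_seq; apply: prodr_ge0 => g gs.
  by have := le_len (c *m g *m v); rewrite cgv// ler_norml => /andP[]; lra.
have pole (u : 'cV[R]_3) k : len u ^+ 2 = k ^+ 2 -> u 2 0 = k -> u = k *: (c *m a).
  rewrite sqr_len /sqn /dot => uk u2.
  have : u 0 0 ^+ 2 + u 1 0 ^+ 2 = 0 by rewrite -u2 in uk; nra.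
  move/eqP; rewrite paddr_eq0 ?sqr_ge0// !sqrf_eq0 => /andP[/eqP u0 /eqP u1].
  by rewrite ca; apply: vec3P; rewrite !mxE /= ?mulr0 ?mulr1.
have ctc := rot_trmxK rc.
apply/negP; rewrite paddr_eq0// /north_prod /south_prod !big_map !prodf_seq_eq0.
case/andP => /hasP[g gs /= /eqP ge] /hasP[h hs /= /eqP he].
have cancel_c u k : c *m u = k *: (c *m a) -> u = k *: a.
  move=> /(congr1 (mulmx c^T)); rewrite mulmxA ctc mul1mx => ->.
  by rewrite -scalemxAr mulmxA ctc mul1mx.
have Eg : g *m v = - len v *: a.
  by apply: cancel_c; rewrite mulmxA; apply: pole; [rewrite cgv// sqrrN|lra].
have Eh : h *m v = len v *: a.
  by apply: cancel_c; rewrite mulmxA; apply: pole; [rewrite cgv|lra].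
have /eqP := ga _ (Gs _ _ gs hs); apply; rewrite -len_eq0 in v0.
apply: (scalerI v0); rewrite scalemxAr -mulmxA -Eh (mulmxA h^T).
by rewrite rot_trmxK ?mul1mx ?Eg ?scaleNr ?scalerN//; exact: rs.
Qed.
End Generic.

(** * Quotients of compact spaces *)

Section Continuity.
Variables (R : realType) (T : topologicalType) (x : T).
Implicit Types f g : T -> R.

Lemma continuous_add f g : continuous_at x f -> continuous_at x g ->
  continuous_at x (fun y => f y + g y).
Proof. exact: cvgD. Qed.

Lemma continuous_mul f g : continuous_at x f -> continuous_at x g ->
  continuous_at x (fun y => f y * g y).
Proof. exact: cvgM. Qed.

Lemma continuous_opp f : continuous_at x f -> continuous_at x (fun y => - f y).
Proof. exact: cvgN. Qed.

Lemma continuous_inv f : f x != 0 -> continuous_at x f ->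
  continuous_at x (fun y => (f y)^-1).
Proof. exact: cvgV. Qed.

Lemma continuous_sqrt f : continuous_at x f ->
  continuous_at x (fun y => Num.sqrt (f y)).
Proof. by move=> cf; apply: continuous_comp cf _; exact: sqrt_continuous. Qed.

Lemma continuous_bigop (I : Type) (op : R -> R -> R) (idx : R) (s : seq I) (f : I ->
  T -> R) :
  (forall g h : T -> R, continuous_at x g -> continuous_at x h ->
     continuous_at x (fun y => op (g y) (h y))) ->
  (forall i, continuous_at x (f i)) ->
  continuous_at x (fun y => \big[op/idx]_(i <- s) f i y).
Proof.
move=> cop cf; elim: s => [|i s IH].
  by under eq_fun do rewrite big_nil; exact: cst_continuous.
by under eq_fun do rewrite big_cons; exact: cop.
Qed.

Lemma continuous_at_ext (U : topologicalType) (f g : T -> U) : f =1 g ->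
  continuous_at x f -> continuous_at x g.
Proof. by move=> /funext ->. Qed.
End Continuity.

Section Topology.

Lemma hausdorff_injective (S T : topologicalType) (f : S -> T) :
  hausdorff_space T -> continuous f -> injective f -> hausdorff_space S.
Proof.
move=> hT cf injf x y xy; apply/injf/hT => A B /cf fA /cf fB.
by have [z [Az Bz]] := xy _ _ fA fB; exists (f z).
Qed.

Lemma hausdorff_set_type (T : topologicalType) (A : set T) :
  hausdorff_space T -> hausdorff_space (set_type A).
Proof.
move=> hT; apply: (@hausdorff_injective _ _ set_val) => //.
exact: initial_continuous.
Qed.

Lemma compact_set_type (T : topologicalType) (A : set T) :
  compact A -> compact [set: set_type A].
Proof.
move=> cA F FF _; have [|a [Aa Fa]] := cA (set_val @ F) _.
  by apply: (@filterS _ F _ setT) filterT => x _; exact: set_valP.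
exists (SigSub (mem_set Aa)); split=> // P Q FP [_ [[V oV <-] Va VQ]].
have [|_ [[x Px <-] Vx]] := Fa (set_val @` P) V _ (open_nbhs_nbhs (conj oV Va)).
  by apply: (@filterS _ F _ P) FP => x Px; exists x.
by exists x; split=> //; exact: VQ.
Qed.

Lemma continuous_mx (R : numFieldType) (T : topologicalType) m n (f : T ->
  'M[R]_(m, n)) :
  (forall i j, continuous (fun t => f t i j)) -> continuous f.
Proof.
move=> cf t A [P fP PA].
have H : \forall u \near t, forall i j, P i j (f u i j).
  by apply: filter_forall => i; apply: filter_forall => j; exact: (cf i j t _ (fP i j)).
by apply: filterS H => u fu; exact: PA.
Qed.

(** For functions given by a quotient whose denominator vanishes with [rho]. *)
Lemma bounded_continuous (R : realType) (T : topologicalType) (f rho : T -> R) :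
  continuous rho -> (forall x, `|f x| <= rho x) ->
  (forall x, rho x != 0 -> continuous_at x f) -> continuous f.
Proof.
move=> crho f_rho cf x; have [rx|/cf//] := eqVneq (rho x) 0.
have fx : f x = 0 by apply/eqP; rewrite -normr_le0 -rx.
have rho0 : rho y @[y --> x] --> (0 : R) by rewrite -rx; exact: crho.
rewrite /continuous_at fx; apply: (squeeze_cvgr (f := fun y => - rho y) (h :=
  rho)) => //.
  by apply: nearW => y; rewrite -ler_norml.
by rewrite -oppr0; exact: cvgN.
Qed.

Definition quotient_map (A X : topologicalType) (p : A -> X) :=
  [/\ continuous p, (forall x, exists a, p a = x) &
      forall C : set X, closed (p @^-1` C) -> closed C].

(** Lets [homeomorphic_quotients] also treat a target that is no quotient. *)
Lemma quotient_map_id (A : topologicalType) : quotient_map (@id A).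
Proof. by split=> [x|x|//]; [exact: cvg_id|exists x]. Qed.

Lemma quotient_map_pi (A : topologicalType) (Q : quotType A) :
  quotient_map (\pi_(quotient_topology Q)%qT : A -> quotient_topology Q).
Proof.
split; first exact: pi_continuous.
  by move=> x; exists (repr x); exact: reprK.
by move=> C cC; rewrite -[C]setCK; apply: open_closedC; exact: (closed_openC cC).
Qed.

(** The preimage of a closed set is, up to [pA], the image under [p] of a closed
subset of the compact space [K]. *)
Lemma compact_fibres_continuous (K A B X Y : topologicalType)
  (p : K -> A) (q : K -> B) (pA : A -> X) (pB : B -> Y) (f : X -> Y) :
  compact [set: K] -> hausdorff_space A -> continuous p -> continuous q ->
  (forall a, exists k, p k = a) -> quotient_map pA -> continuous pB ->
  (forall k, f (pA (p k)) = pB (q k)) -> continuous f.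
Proof.
move=> cK hA cp cq sp [cA sA qA] cB fE; apply/continuous_closedP => C cC.
apply: qA.
have -> : pA @^-1` (f @^-1` C) = p @` (q @^-1` (pB @^-1` C)).
  apply/seteqP; split=> [a /= fa|_ [k qk <-] /=]; last by rewrite fE.
  by have [k pk] := sp a; exists k => //=; rewrite -fE pk.
apply: compact_closed => //; apply: continuous_compact.
  exact: continuous_subspaceT.
apply: (subclosed_compact _ cK) => //.
by move/continuous_closedP: cq; apply; move/continuous_closedP: cB; exact.
Qed.

(** Both [X] and [Y] carry the quotient topology of [K] for the same equivalence
relation. *)
Lemma homeomorphic_quotients (K A B X Y : topologicalType)
  (p : K -> A) (q : K -> B) (pA : A -> X) (pB : B -> Y) :
  compact [set: K] -> hausdorff_space A -> hausdorff_space B ->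
  continuous p -> continuous q ->
  (forall a, exists k, p k = a) -> (forall b, exists k, q k = b) ->
  quotient_map pA -> quotient_map pB ->
  (forall k k', pA (p k) = pA (p k') <-> pB (q k) = pB (q k')) ->
  homeomorphic X Y.
Proof.
move=> cK hA hB cp cq sp sq qA qB fib.
have [cA sA _] := qA; have [cB sB _] := qB.
have /choice[f fP] : forall x, exists y, forall k, pA (p k) = x -> pB (q k) = y.
  move=> x; have [a <-] := sA x; have [k <-] := sp a.
  by exists (pB (q k)) => k' /fib.
have /choice[g gP] : forall y, exists x, forall k, pB (q k) = y -> pA (p k) = x.
  move=> y; have [b <-] := sB y; have [k <-] := sq b.
  by exists (pA (p k)) => k' /fib.
exists f, g; split.
- move=> x; have [a <-] := sA x; have [k <-] := sp a.
  by rewrite -(gP (f (pA (p k))) k)//; exact: fP.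
- move=> y; have [b <-] := sB y; have [k <-] := sq b.
  by rewrite -(fP (g (pB (q k))) k)//; exact: gP.
- apply: (compact_fibres_continuous (pA := pA) (pB := pB) cK hA cp cq) => // k.
  by rewrite (fP _ k erefl).
- apply: (compact_fibres_continuous (pA := pB) (pB := pA) cK hB cq cp) => // k.
  by rewrite (gP _ k erefl).
Qed.

Lemma compact_sphere (R : realType) d : compact [set: sphere R d].
Proof.
apply: compact_set_type.
have H := @rV_compact R d.+1 (fun=> `[-1, 1]%classic) (fun=> @segment_compact R (-1) 1).
apply: (subclosed_compact _ H).
  have c : continuous (fun x : 'rV[R]_d.+1 => \sum_(i < d.+1) x ord0 i ^+ 2).
    move=> x; apply: continuous_bigop => [|i]; first exact: continuous_add.
    under eq_fun do rewrite expr2.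
    by apply: continuous_mul; exact: coord_continuous.
  move/continuous_closedP: c => /(_ [set 1]); apply.
  by apply: accessible_closed_set1; apply: hausdorff_accessible; exact: Rhausdorff.
move=> x x1 i /=; rewrite in_itv /= -ler_norml -(ler_pXn2r (_ : 0 < 2)%N)// ?nnegrE//.
rewrite expr1n real_normK ?num_real// -x1 (bigD1 i)//= lerDl.
by apply: sumr_ge0 => j _; exact: sqr_ge0.
Qed.

Lemma hausdorff_sphere (R : realType) d : hausdorff_space (sphere R d).
Proof. by apply: hausdorff_set_type; exact: norm_hausdorff. Qed.

Lemma hausdorff_SO (R : realType) m : hausdorff_space (SO R m.+1).
Proof. by apply: hausdorff_set_type; exact: norm_hausdorff. Qed.
End Topology.

(** * The three-sphere as the unit quaternions *)

Section SphereCoordinates.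
Variable R : realType.
Local Notation C := (complex R).
Local Notation S3 := (sphere R 3).
Local Notation is_rot := (@SO_set R 3).
Implicit Types (k : S3) (t : R) (v : 'cV[R]_3).

Lemma forall_I4 (P : 'I_4 -> Prop) : P 0 -> P 1 -> P 2 -> P 3 -> forall i, P i.
Proof.
move=> P0 P1 P2 P3 [[|[|[|[|//]]]] lti].
- by rewrite (_ : Ordinal lti = 0)//; apply: val_inj.
- by rewrite (_ : Ordinal lti = 1)//; apply: val_inj.
- by rewrite (_ : Ordinal lti = 2)//; apply: val_inj.
- by rewrite (_ : Ordinal lti = 3)//; apply: val_inj.
Qed.

Lemma sum_I4 (V : nmodType) (F : 'I_4 -> V) : \sum_(i < 4) F i = F 0 + F 1 + F 2 + F 3.
Proof.
rewrite !big_ord_recr big_ord0 /= add0r.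
by congr (F _ + F _ + F _ + F _); apply: val_inj.
Qed.

Definition qre k : R := set_val k 0 0.
Definition qim k : 'cV[R]_3 := vec3 (set_val k 0 1) (set_val k 0 2) (set_val k 0 3).
Definition quat_row t v : 'rV[R]_4 := \row_i [:: t; v 0 0; v 1 0; v 2 0]`_i.

Lemma quat_row_sphere t v : t * t + sqn v = 1 -> @sphere_set R 3 (quat_row t v).
Proof. by rewrite /sphere_set /= sum_I4 !mxE /= /sqn /dot => <-; ring. Qed.

Definition sphere_point t v (tv : t * t + sqn v = 1) : S3 :=
  SigSub (mem_set (quat_row_sphere tv)).

Lemma sphere_sqn k : qre k * qre k + sqn (qim k) = 1.
Proof.
have : @sphere_set R 3 (set_val k) by exact: set_valP.
by rewrite /sphere_set /= sum_I4 /sqn /dot !vec3E => <-; rewrite /qre; ring.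
Qed.

Lemma sphereP k k' : qre k = qre k' -> qim k = qim k' -> k = k'.
Proof.
move=> e0 /matrixP e; apply/val_inj/matrixP => i; rewrite ord1.
have := (e 0 0, e 1 0, e 2 0); rewrite !vec3E => -[[e1 e2] e3].
exact: forall_I4.
Qed.

Lemma qre_sphere_point t v tv : qre (@sphere_point t v tv) = t.
Proof. by rewrite /qre /sphere_point /set_val /= mxE. Qed.

Lemma qim_sphere_point t v tv : qim (@sphere_point t v tv) = v.
Proof. by rewrite /qim /sphere_point; apply: vec3P; rewrite vec3E /set_val /= mxE. Qed.

Lemma continuous_coord i : continuous (fun k => set_val k 0 i).
Proof.
move=> k; apply: (@continuous_comp S3 _ _ set_val (fun x : 'rV[R]_4 => x 0 i)).
  exact: initial_continuous.
exact: coord_continuous.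
Qed.

Lemma continuous_qre : continuous qre. Proof. exact: continuous_coord. Qed.

Lemma continuous_qim i : continuous (fun k => qim k i 0).
Proof.
by move: i; apply: forall_I3; rewrite /qim; under eq_fun do rewrite vec3E;
  exact: continuous_coord.
Qed.

Lemma continuous_to_sphere (T : topologicalType) (f : T -> S3) :
  continuous (qre \o f) -> (forall i, continuous (fun x => qim (f x) i 0)) ->
    continuous f.
Proof.
move=> c0 c; apply: continuous_comp_initial; apply: continuous_mx => i; rewrite ord1.
have cE (g : T -> R) j : (fun x => qim (f x) j 0) =1 g -> continuous g.
  by move=> gE x; apply: continuous_at_ext gE (c j x).
by apply: forall_I4 => //; [apply: (cE _ 0)|apply: (cE _ 1)|apply: (cE _ 2)] => x;
  rewrite vec3E.
Qed.

Lemma rodrigues_continuous (T : topologicalType) (f : T -> R) (g : T -> 'cV[R]_3) x :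
  continuous_at x f -> (forall i, continuous_at x (fun y => g y i 0)) ->
  forall i j, continuous_at x (fun y => rodrigues (f y) (g y) i j).
Proof.
move=> cf cg.
have cst2 : continuous_at x (fun=> 2 : R) by exact: cst_continuous.
have cd0 : continuous_at x (fun y => f y * f y - sqn (g y)).
  apply: continuous_add; [exact: continuous_mul|apply: continuous_opp].
  exact: (continuous_add (continuous_add (continuous_mul (cg 0) (cg 0))
    (continuous_mul (cg 1) (cg 1))) (continuous_mul (cg 2) (cg 2))).
have cdiag i : continuous_at x (fun y => f y * f y - sqn (g y) + 2 * g y i 0 * g y i 0).
  by apply: continuous_add cd0 _; apply: continuous_mul (cg i);
    exact: continuous_mul (cg i).
have cpos i j l : continuous_at x (fun y => 2 * g y i 0 * g y j 0 + 2 * f y * g y l 0).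
  by apply: continuous_add; [apply: continuous_mul (cg j)|apply: continuous_mul (cg
    l)]; apply: continuous_mul.
have cneg i j l : continuous_at x (fun y => 2 * g y i 0 * g y j 0 - 2 * f y * g y l 0).
  by apply: continuous_add; [apply: continuous_mul (cg
    j)|apply/continuous_opp/continuous_mul/(cg l)]; apply: continuous_mul.
by apply: forall_I3; apply: forall_I3;
  [ apply: continuous_at_ext (cdiag 0)| apply: continuous_at_ext (cneg 0 1 2)
  | apply: continuous_at_ext (cpos 0 2 1)| apply: continuous_at_ext (cpos 1 0 2)
  | apply: continuous_at_ext (cdiag 1)| apply: continuous_at_ext (cneg 1 2 0)
  | apply: continuous_at_ext (cneg 2 0 1)| apply: continuous_at_ext (cpos 2 1 0)
  | apply: continuous_at_ext (cdiag 2)] => y; rewrite !m3E.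
Qed.

Definition euler_rodrigues k : SO R 3 :=
  SigSub (mem_set (rodrigues_rot (sphere_sqn k))).

Lemma continuous_euler_rodrigues : continuous euler_rodrigues.
Proof.
apply: continuous_comp_initial; apply: continuous_mx => i j x.
by apply: rodrigues_continuous => [|l]; [exact: continuous_qre|exact: continuous_qim].
Qed.

Lemma euler_rodrigues_surj (A : SO R 3) : exists k, euler_rodrigues k = A.
Proof.
have [t [v [tv tvA]]] := rodrigues_surj (set_valP A).
by exists (sphere_point tv); apply: val_inj;
  rewrite /= qre_sphere_point qim_sphere_point.
Qed.

Lemma len_continuous : continuous (fun k => len (qim k)).
Proof.
move=> k; apply: continuous_sqrt; 
have c i := continuous_mul (@continuous_qim i k) (@continuous_qim i k).
by apply: continuous_at_ext (continuous_add (continuous_add (c 0) (c 1)) (c 2)).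
Qed.

Section OrbitMapContinuity.
Variable (L : seq 'M[R]_3).
Hypothesis Lrot : {in L, forall M, is_rot M}.
Hypothesis nondeg : forall v, v != 0 -> north_prod L v + south_prod L v != 0.

Lemma mulmx_qim_continuous (M : 'M[R]_3) i : continuous (fun k => (M *m qim k) i 0).
Proof.
move=> k; have c j : continuous_at k (fun k => M i j * qim k j 0).
  by apply: continuous_mul; [exact: cst_continuous|exact: continuous_qim].
apply: continuous_at_ext (continuous_add (continuous_add (c 0) (c 1)) (c 2)) => y.
by rewrite mulmx_vec3.
Qed.

Lemma north_prod_continuous : continuous (fun k => north_prod L (qim k)).
Proof.
move=> k; apply: continuous_bigop => [|M]; first exact: continuous_mul.
by apply: continuous_add; [exact: len_continuous|exact: mulmx_qim_continuous].
Qed.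

Lemma south_prod_continuous : continuous (fun k => south_prod L (qim k)).
Proof.
move=> k; apply: continuous_bigop => [|M]; first exact: continuous_mul.
apply: continuous_add; first exact: len_continuous.
by apply: continuous_opp; exact: mulmx_qim_continuous.
Qed.

Lemma equator_prod_continuous : continuous (fun k => complex.Re (equator_prod L (qim
  k))) /\
  continuous (fun k => complex.Im (equator_prod L (qim k))).
Proof.
rewrite /equator_prod; elim: (L) => [|M L' [IHr IHi]].
  by split; under eq_fun do rewrite big_nil; exact: cst_continuous.
have EC (x : C) a b : (complex.Re (Complex a b * x) =
  a * complex.Re x - b * complex.Im x) *
   (complex.Im (Complex a b * x) = a * complex.Im x + b * complex.Re x).
  by case: x.
have c i := @mulmx_qim_continuous M i.
split=> k.
  apply: continuous_at_ext (continuous_add (continuous_mul (c 0 k) (IHr k))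
    (continuous_opp (continuous_mul (c 1 k) (IHi k)))) => y.
  by rewrite big_cons EC.
apply: continuous_at_ext (continuous_add (continuous_mul (c 0 k) (IHi k))
  (continuous_mul (c 1 k) (IHr k))) => y.
by rewrite big_cons EC.
Qed.

Lemma coord_le_len v i : `|v i 0| <= len v.
Proof.
rewrite -(ler_pXn2r (_ : 0 < 2)%N)// ?nnegrE ?len_ge0// real_normK ?num_real//
  sqr_len /sqn /dot.
rewrite -!expr2; move: i; apply: forall_I3.
- by rewrite -addrA lerDl addr_ge0 ?sqr_ge0.
- by rewrite addrAC lerDr addr_ge0 ?sqr_ge0.
- by rewrite lerDr addr_ge0 ?sqr_ge0.
Qed.

Lemma orbit_map_continuous i : continuous (fun k => orbit_map L (qim k) i 0).
Proof.
apply: (bounded_continuous len_continuous) => [k|k].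
  by rewrite -(len_orbit_map Lrot nondeg); exact: coord_le_len.
rewrite len_eq0 => /nondeg D0.
have D : continuous_at k (fun k => len (qim k) / (north_prod L (qim k) + south_prod L
  (qim k))).
  apply: continuous_mul; first exact: len_continuous.
  apply: continuous_inv => //; apply: continuous_add.
    exact: north_prod_continuous.
  exact: south_prod_continuous.
have [cr ci] := equator_prod_continuous.
have c2 : continuous_at k (fun=> 2 : R) by exact: cst_continuous.
have c0 := continuous_mul D (continuous_mul c2 (cr k)).
have c1 := continuous_mul D (continuous_mul c2 (ci k)).
have c3 := continuous_mul D
  (continuous_add (@north_prod_continuous k) (continuous_opp (@south_prod_continuous
    k))).
by move: i; apply: forall_I3; [apply: continuous_at_ext c0|apply: continuous_at_ext c1
  |apply: continuous_at_ext c3] => y; rewrite mxE vec3E.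
Qed.

Lemma orbit_sphere_map_subproof k : qre k * qre k + sqn (orbit_map L (qim k)) = 1.
Proof. by rewrite (sqn_orbit_map Lrot nondeg) sphere_sqn. Qed.

(** The suspension of the orbit map of the 2-sphere. *)
Definition orbit_sphere_map k := sphere_point (orbit_sphere_map_subproof k).

Lemma orbit_sphere_map_continuous : continuous orbit_sphere_map.
Proof.
apply: continuous_to_sphere => [|i]; rewrite /comp.
  by under eq_fun do rewrite qre_sphere_point; exact: continuous_qre.
by under eq_fun do rewrite qim_sphere_point; exact: orbit_map_continuous.
Qed.

End OrbitMapContinuity.
End SphereCoordinates.

(** * The quotient of the three-sphere by a half-turn *)

Section FoldSphere.
Variable R : realType.
Local Notation S3 := (sphere R 3).
Implicit Types (t c : R) (k : S3).

Definition cabs t c := Num.sqrt (t * t + c * c).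
(** With [fold_im], the square of the complex number [t + i c] divided by its
modulus. *)
Definition fold_re t c := (t * t - c * c) / cabs t c.
Definition fold_im t c := 2 * t * c / cabs t c.

Lemma sqr_cabs t c : cabs t c * cabs t c = t * t + c * c.
Proof. by rewrite -expr2 sqr_sqrtr// addr_ge0 // -expr2 sqr_ge0. Qed.

Lemma fold_sqr t c : fold_re t c * fold_re t c + fold_im t c * fold_im t c =
  t * t + c * c.
Proof.
rewrite /fold_re /fold_im; have := sqr_cabs t c; move: (cabs t c) => r.
have [-> <-|r0 rr] := eqVneq r 0; first by rewrite invr0 !mulr0 addr0.
apply: (mulfI (mulf_neq0 r0 r0)).
rewrite [RHS](_ : _ = (t * t + c * c) * (t * t + c * c)); last by rewrite rr.
by field.
Qed.

Lemma fold_inj t c t' c' : fold_re t c = fold_re t' c' -> fold_im t c = fold_im t' c' ->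
  (t = t' /\ c = c') \/ (t = - t' /\ c = - c').
Proof.
move=> er ei; have := fold_sqr t c; rewrite er ei fold_sqr => tc.
have [r0|r0] := eqVneq (cabs t c) 0.
  have {r0} : t ^+ 2 + c ^+ 2 = 0 by rewrite !expr2 -sqr_cabs r0 mul0r.
  have z (a b : R) : a ^+ 2 + b ^+ 2 = 0 -> a = 0 /\ b = 0.
    by move/eqP; rewrite paddr_eq0 ?sqr_ge0// !sqrf_eq0 => /andP[/eqP ? /eqP ?].
  move=> /z[t0 c0]; move: tc; rewrite t0 c0 mulr0 addr0.
  by rewrite -!expr2 => /z[-> ->]; left.
move: er ei; rewrite /fold_re /fold_im (_ : cabs t' c' = cabs t c);
  last by rewrite /cabs tc.
move=> /(divIf r0) er /(divIf r0) ei.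
have tt : t * t = t' * t' by lra.
have cc : c * c = c' * c' by lra.
have tc' : t * c = t' * c' by lra.
have /eqP : (t - t') * (t + t') = 0 by transitivity (t * t - t' * t');
  [ring|rewrite tt subrr].
rewrite mulf_eq0 subr_eq0 addr_eq0.
have [t0 _|t0] := eqVneq t 0.
  have t'0 : t' = 0 by apply/eqP; rewrite -sqrf_eq0 expr2 -tt t0 mulr0.
  have /eqP : (c - c') * (c + c') = 0 by transitivity (c * c - c' * c');
    [ring|rewrite cc subrr].
  rewrite mulf_eq0 subr_eq0 addr_eq0 t0 t'0 oppr0 => /orP[]/eqP ->; by [left|right].
move=> /orP[]/eqP tE; [left|right]; split=> //; apply: (mulfI t0); rewrite tc' tE; ring.
Qed.

Lemma fold_surj a b : exists t c, fold_re t c = a /\ fold_im t c = b.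
Proof.
have [ab0|ab0] := eqVneq (cabs a b) 0.
  have := sqr_cabs a b; rewrite ab0 mul0r => /esym/eqP;
    rewrite -!expr2 paddr_eq0 ?sqr_ge0//.
  rewrite !sqrf_eq0 => /andP[/eqP -> /eqP ->].
  by exists 0, 0; rewrite /fold_re /fold_im /cabs !mulr0 addr0 sqrtr0 invr0 !mulr0.
have := sqr_sqrtc (Complex (cabs a b * a) (cabs a b * b)).
case: (sqrtc _) => t c /eqP; rewrite expr2 eq_complex /= => /andP[/eqP Et /eqP Ec].
have rr := sqr_cabs a b.
have tc : t * t + c * c = cabs a b * cabs a b.
  apply/eqP; rewrite -(@eqrXn2 _ 2)// ?addr_ge0// -?expr2 ?sqr_ge0// ?expr2.
  apply/eqP; transitivity ((t * t - c * c) * (t * t - c * c) + (t * c + c * t) * (t *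
    c + c * t)).
    by ring.
  rewrite Et Ec; transitivity (cabs a b * cabs a b * (a * a + b * b)); first by ring.
  by rewrite -rr.
have -> : fold_re = fun t c => (t * t - c * c) / cabs t c by [].
exists t, c; rewrite /fold_im.
have -> : cabs t c = cabs a b
  by rewrite {1}/cabs tc -expr2 sqrtr_sqr ger0_norm// sqrtr_ge0.
split; apply: (mulIf ab0); rewrite divfK//; first by rewrite Et mulrC.
by rewrite [RHS]mulrC -Ec; ring.
Qed.

Lemma fold_sphere_subproof k :
  fold_re (qre k) (qim k 2 0) * fold_re (qre k) (qim k 2 0) +
  sqn (vec3 (qim k 0 0) (qim k 1 0) (fold_im (qre k) (qim k 2 0))) = 1.
Proof.
have := fold_sqr (qre k) (qim k 2 0);
  rewrite -(sphere_sqn k) /sqn /dot [vec3 _ _ _ 0 0]vec3E.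
rewrite [vec3 _ _ (fold_im _ _) 1 0]vec3E [vec3 _ _ (fold_im _ _) 2 0]vec3E; lra.
Qed.

(** The fibres are the orbits of the half-turn that changes the signs of the real
coordinate and of the third imaginary one ([fold_sphere_fibre]). *)
Definition fold_sphere k : S3 := sphere_point (fold_sphere_subproof k).

Lemma fold_sphere_continuous : continuous fold_sphere.
Proof.
have csq (f : S3 -> R) k : continuous_at k f -> continuous_at k (fun y => f y * f y).
  by move=> cf; exact: continuous_mul.
have cre k := csq _ k (@continuous_qre R k);
  have cim k := csq _ k (@continuous_qim R 2 k).
have ca : continuous (fun k => cabs (qre k) (qim k 2 0)).
  by move=> k; apply: continuous_at_ext (continuous_sqrt (continuous_add (cre k) (cim
    k))) => y.
have cai k : cabs (qre k) (qim k 2 0) != 0 ->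
    continuous_at k (fun y => (cabs (qre y) (qim y 2 0))^-1).
  by move=> k0; apply: continuous_inv => //; exact: ca.
have le1 (x y r : R) : x * x + y * y = r * r -> 0 <= r -> `|x| <= r.
  move=> xy r0; rewrite -(ler_pXn2r (_ : 0 < 2)%N)// ?nnegrE// real_normK ?num_real//.
  by rewrite !expr2 -xy lerDl -expr2 sqr_ge0.
apply: continuous_to_sphere => [|i]; rewrite /comp.
  under eq_fun do rewrite qre_sphere_point.
  apply: (bounded_continuous ca) => [k|k k0].
    by apply: le1 (sqrtr_ge0 _); rewrite sqr_cabs; exact: fold_sqr.
  by apply: continuous_at_ext (continuous_mul (continuous_add (cre k) (continuous_opp
    (cim k)))
    (cai k k0)) => y.
under eq_fun do rewrite qim_sphere_point.
move: i; apply: forall_I3.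
- by move=> k; apply: continuous_at_ext (@continuous_qim R 0 k) => y;
    rewrite [vec3 _ _ (fold_im _ _) 0 0]vec3E.
- by move=> k; apply: continuous_at_ext (@continuous_qim R 1 k) => y;
    rewrite [vec3 _ _ (fold_im _ _) 1 0]vec3E.
suff cf : continuous (fun k => fold_im (qre k) (qim k 2 0)).
  by move=> k; apply: continuous_at_ext (cf k) => y;
    rewrite [vec3 _ _ (fold_im _ _) 2 0]vec3E.
apply: (bounded_continuous ca) => [k|k k0].
  by apply: le1 (sqrtr_ge0 _); rewrite sqr_cabs addrC; exact: fold_sqr.
have c2 : continuous_at k (fun=> 2 : R) by exact: cst_continuous.
by apply: continuous_at_ext (continuous_mul (continuous_mul (continuous_mul c2
  (@continuous_qre R k)) (@continuous_qim R 2 k)) (cai k k0)) => y.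
Qed.

Lemma fold_sphere_surj k : exists k', fold_sphere k' = k.
Proof.
have [t [c [tE cE]]] := fold_surj (qre k) (qim k 2 0).
have h : t * t + sqn (vec3 (qim k 0 0) (qim k 1 0) c) = 1.
  have := fold_sqr t c; rewrite tE cE -(sphere_sqn k) /sqn /dot [vec3 _ _ _ 0 0]vec3E.
  rewrite [vec3 _ _ c 1 0]vec3E [vec3 _ _ c 2 0]vec3E; lra.
exists (sphere_point h); apply: sphereP;
  rewrite /fold_sphere ?qre_sphere_point ?qim_sphere_point [vec3 _ _ c 2 0]vec3E.
  exact: tE.
by rewrite qre_sphere_point cE [vec3 _ _ c 0 0]vec3E [vec3 _ _ c 1 0]vec3E;
  apply: vec3P; rewrite vec3E.
Qed.

Lemma fold_sphere_fibre k k' : fold_sphere k = fold_sphere k' <->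
  k = k' \/ (qre k = - qre k' /\ qim k = vec3 (qim k' 0 0) (qim k' 1 0) (- qim k' 2 0)).
Proof.
split=> [E|[->//|[E0 E1]]].
  have := (congr1 (@qre R) E, congr1 (@qim R) E);
    rewrite /fold_sphere !qre_sphere_point !qim_sphere_point => -[er /matrixP e].
  have := (e 0 0, e 1 0, e 2 0).
  rewrite ![vec3 _ _ (fold_im _ _) _ _]vec3E => -[[e0 e1] e2].
  have [[r i]|[r i]] := fold_inj er e2.
    by left; apply: sphereP => //; exact: vec3P.
  by right; split=> //; apply: vec3P; rewrite [vec3 _ _ (- _) _ _]vec3E.
have e := (congr1 (fun v : 'cV[R]_3 => v 0 0) E1,
  congr1 (fun v : 'cV[R]_3 => v 1 0) E1, congr1 (fun v : 'cV[R]_3 => v 2 0) E1).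
move: e; rewrite /= ![vec3 _ _ (- _) _ _]vec3E => -[[e0 e1] e2].
have ab : cabs (- qre k') (- qim k' 2 0) = cabs (qre k') (qim k' 2 0).
  by rewrite /cabs !mulrNN.
have fr : fold_re (- qre k') (- qim k' 2 0) = fold_re (qre k') (qim k' 2 0).
  by rewrite /fold_re ab !mulrNN.
have fi : fold_im (- qre k') (- qim k' 2 0) = fold_im (qre k') (qim k' 2 0).
  by rewrite /fold_im ab; congr (_ / _); ring.
apply: sphereP; rewrite /fold_sphere ?qim_sphere_point ?qre_sphere_point E0 e2;
  first exact: fr.
by rewrite fi e0 e1.
Qed.
End FoldSphere.

(** * Conjugation orbits of a finite group of rotations *)

Section Main.
Variable R : realType.
Local Notation S3 := (sphere R 3).
Local Notation is_rot := (@SO_set R 3).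

Lemma finite_group_seq (G : groupClosed (SO R 3)) (n : nat) : [set` G] #= `I_n ->
  exists s : seq 'M[R]_3, [/\ uniq s, size s = n, {in s, forall g, is_rot g},
    1%:M \in s & {in s &, forall g h, g *m h^T \in s} /\
    forall x y : SO R 3, conj_orbit_rel G x y <->
      exists2 g, g \in s & set_val y = g *m set_val x *m g^T].
Proof.
move=> cG; pose s : seq (SO R 3) := finmap.enum_fset (fset_set [set` G]).
have us : uniq s by exact: finmap.fset_uniq.
have sG x : (x \in s) = (x \in G).
  have := @in_fset_set _ [set` G] (ex_intro _ n cG) x.
  by rewrite mem_setE.
exists (map val s); split.
- by rewrite map_inj_uniq//; exact: val_inj.
- by rewrite size_map; exact: card_fset_set.
- by move=> _ /mapP[x _ ->]; exact: set_valP.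
- by apply/mapP; exists 1%g; rewrite ?sG ?gpred1.
split.
  move=> _ _ /mapP[x sx ->] /mapP[y sy ->]; apply/mapP; exists (x * y^-1)%g => //.
  by rewrite sG gpredM ?gpredV// -sG.
move=> x y; split=> [/asboolP[g gG ->]|[_ /mapP[g gs ->] yE]].
  by exists (val g) => //; apply/map_f; rewrite sG.
by apply/asboolP; exists g; rewrite -?sG//; apply: val_inj.
Qed.

Section FixedGroup.
Variables (G : groupClosed (SO R 3)) (s : seq 'M[R]_3) (c : 'M[R]_3).
Hypotheses (us : uniq s) (rs : {in s, forall g, is_rot g}) (s1 : 1%:M \in s).
Hypothesis sM : {in s &, forall g h, g *m h^T \in s}.
Hypothesis sG : forall x y : SO R 3, conj_orbit_rel G x y <->
      exists2 g, g \in s & set_val y = g *m set_val x *m g^T.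
Hypothesis rc : is_rot c.
Let L := [seq c *m g | g <- s].
Hypothesis nondeg : forall v, v != 0 -> north_prod L v + south_prod L v != 0.

Let c_inj : injective (mulmx c : 'M[R]_3 -> 'M[R]_3).
Proof. by move=> g h /(congr1 (mulmx c^T)); rewrite !mulmxA rot_trmxK// !mul1mx. Qed.
Let uL : uniq L. Proof. by rewrite map_inj_uniq. Qed.
Let rL : {in L, forall M, is_rot M}.
Proof. by move=> _ /mapP[g /rs gr ->]; exact: SO_setM. Qed.
Let L0 : L != [::]. Proof. by rewrite /L; case: (s) s1. Qed.

Let sV g : g \in s -> g^T \in s. Proof. by move=> /(sM s1); rewrite mul1mx. Qed.
Let sMM g h : g \in s -> h \in s -> g *m h \in s.
Proof. by move=> gs /sV hs; rewrite -[h]trmxK; exact: sM. Qed.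

Let orbit_map_s g v : g \in s -> orbit_map L (g *m v) = orbit_map L v.
Proof.
move=> gs; apply: orbit_map_invariant; first exact: rs.
have gI : injective (mulmx^~ g : 'M[R]_3 -> 'M[R]_3).
  move=> a b /(congr1 (mulmx^~ g^T)); rewrite -!mulmxA.
  by have [-> _] := rs gs; rewrite !mulmx1.
apply: uniq_perm => //; first by rewrite map_inj_uniq.
move=> M; apply/mapP/mapP => [[_ /mapP[h hs ->] ->]|[h hs ->]].
  by exists (h *m g); rewrite ?mulmxA//; exact: sMM.
exists (c *m (h *m g^T)); first by apply: map_f; exact: sM.
by rewrite -!mulmxA rot_trmxK ?mulmx1//; exact: rs.
Qed.

Lemma orbit_map_orbit v v' : orbit_map L v = orbit_map L v' <->
  exists2 g, g \in s & g *m v = v'.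
Proof.
split=> [|[g gs <-]]; last by rewrite orbit_map_s.
have inv : {in L, forall M w, orbit_map L (c^T *m (M *m w)) = orbit_map L w}.
  by move=> _ /mapP[g gs ->] w; rewrite !mulmxA rot_trmxK// mul1mx orbit_map_s.
case/(orbit_map_fibre rL rc nondeg inv L0 uL) => _ /mapP[g gs ->] E.
by exists g => //; rewrite -E !mulmxA rot_trmxK// mul1mx.
Qed.

Lemma orbit_sphere_map_surj k : exists k', orbit_sphere_map rL nondeg k' = k.
Proof.
have [v vE] := orbit_map_surj rL nondeg (qim k) L0.
have h : qre k * qre k + sqn v = 1.
  by rewrite -(sqn_orbit_map rL nondeg) vE sphere_sqn.
by exists (sphere_point h); apply: sphereP;
  rewrite /orbit_sphere_map ?qre_sphere_point// !qim_sphere_point.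
Qed.

Lemma orbit_sphere_map_orbit k k' :
  orbit_sphere_map rL nondeg k = orbit_sphere_map rL nondeg k' <->
  qre k = qre k' /\ exists2 g, g \in s & g *m qim k = qim k'.
Proof.
split=> [E|[E0 /orbit_map_orbit E1]].
  have := (congr1 (@qre R) E, congr1 (@qim R) E).
  by rewrite /orbit_sphere_map !qre_sphere_point !qim_sphere_point => -[->
    /orbit_map_orbit].
by apply: sphereP; rewrite /orbit_sphere_map ?qre_sphere_point ?qim_sphere_point.
Qed.

Local Notation piG := (\pi_(coset_space G)%qT : SO R 3 -> coset_space G).

Lemma coset_fibre k k' : piG (euler_rodrigues k) = piG (euler_rodrigues k') <->
  (qre k = qre k' /\ exists2 g, g \in s & g *m qim k = qim k') \/
  (qre k = - qre k' /\ exists2 g, g \in s & g *m qim k = - qim k').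
Proof.
have -> : (piG (euler_rodrigues k) = piG (euler_rodrigues k')) <->
  conj_orbit_rel G (euler_rodrigues k) (euler_rodrigues k').
  by split=> [/eqmodP|/eqmodP].
rewrite sG /=; split=> [[g gs]|].
  rewrite rodrigues_conj; last exact: rs.
  case/esym/rodrigues_eq; first by rewrite rot_sqn ?sphere_sqn//; exact: rs.
  - exact: sphere_sqn.
  - by move=> [E0 E1]; left; split=> //; exists g.
  - by move=> [E0 E1]; right; split=> //; exists g.
case=> -[E0 [g gs E1]]; exists g => //; (rewrite rodrigues_conj; last exact: rs).
  by rewrite E0 E1.
by rewrite E0 E1 rodriguesN.
Qed.

(** [orbit_map] is odd, so that the sign of the quaternion becomes the sign of its
image. *)
Lemma orbit_sphere_map_fibre_odd k k' : odd (size s) ->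
  piG (euler_rodrigues k) = piG (euler_rodrigues k') <->
  (\pi_(projective_space R 3)%qT (orbit_sphere_map rL nondeg k)
    : projective_space R 3) =
  \pi_(projective_space R 3)%qT (orbit_sphere_map rL nondeg k').
Proof.
move=> os; rewrite coset_fibre; have oL : odd (size L) by rewrite size_map.
have -> : forall x y : S3, (\pi_(projective_space R 3)%qT x =
  \pi_(projective_space R 3)%qT y)
    <-> @antipodal_rel R 3 x y by move=> x y; split=> [/eqmodP|/eqmodP].
have -> :
    antipodal_rel (orbit_sphere_map rL nondeg k) (orbit_sphere_map rL nondeg k') <->
    orbit_sphere_map rL nondeg k = orbit_sphere_map rL nondeg k' \/
    (qre k = - qre k' /\ orbit_map L (qim k) = - orbit_map L (qim k')).
  have NE (x y : S3) : set_val y = - set_val x <-> qre x = - qre y /\ qim x = - qim y.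
    split=> [E|[E0 E1]].
      rewrite /qre /qim E; split; first by rewrite mxE opprK.
      by apply: vec3P; rewrite !mxE opprK.
    apply/matrixP => i; rewrite ord1.
    have := (congr1 (fun v : 'cV[R]_3 => v 0 0) E1,
      congr1 (fun v : 'cV[R]_3 => v 1 0) E1,
      congr1 (fun v : 'cV[R]_3 => v 2 0) E1).
    move: E0; rewrite /qre !mxE /= => e0 [[e1 e2] e3].
    by apply: forall_I4; rewrite mxE ?e0 ?e1 ?e2 ?e3 opprK.
  split=> [/orP[/eqP/val_inj->|/eqP/NE]|[->|E]]; first by left.
  - by rewrite /orbit_sphere_map !qre_sphere_point !qim_sphere_point; right.
  - by rewrite /antipodal_rel eqxx.
  - apply/orP; right; apply/eqP/NE.
    by rewrite /orbit_sphere_map !qre_sphere_point !qim_sphere_point.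
rewrite orbit_sphere_map_orbit -orbit_mapN_odd//.
by split=> -[H|[E0 /orbit_map_orbit H]]; [left|right|left|right].
Qed.

(** Negating the quaternion turns its image by the half-turn that [fold_sphere]
forgets. *)
Lemma orbit_sphere_map_fibre_even k k' : ~~ odd (size s) ->
  piG (euler_rodrigues k) = piG (euler_rodrigues k') <->
    fold_sphere (orbit_sphere_map rL nondeg k) =
      fold_sphere (orbit_sphere_map rL nondeg k').
Proof.
move=> os; have oL : ~~ odd (size L) by rewrite size_map.
rewrite coset_fibre fold_sphere_fibre orbit_sphere_map_orbit /orbit_sphere_map
  !qre_sphere_point !qim_sphere_point -orbit_mapN_even//.
by split=> -[H|[E0 /orbit_map_orbit H]]; [left|right|left|right].
Qed.

Let homeomorphic_coset_space (Y : topologicalType) (q : S3 -> S3) (pY : S3 -> Y) :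
  continuous q -> (forall b, exists k, q k = b) -> quotient_map pY ->
  (forall k k', piG (euler_rodrigues k) = piG (euler_rodrigues k') <->
    pY (q k) = pY (q k')) ->
  homeomorphic (coset_space G) Y.
Proof.
move=> cq sq qY fib.
exact: (homeomorphic_quotients (@compact_sphere R 3) (@hausdorff_SO R 2)
  (@hausdorff_sphere R 3) (@continuous_euler_rodrigues R) cq
  (@euler_rodrigues_surj R) sq (quotient_map_pi _) qY fib).
Qed.

Lemma coset_space_odd : odd (size s) ->
  homeomorphic (coset_space G) (projective_space R 3).
Proof.
move=> os.
apply: (homeomorphic_coset_space (@orbit_sphere_map_continuous R L rL nondeg)
  orbit_sphere_map_surj).
  exact: quotient_map_pi.
by move=> k k'; exact: orbit_sphere_map_fibre_odd.
Qed.

Lemma coset_space_even : ~~ odd (size s) ->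
  homeomorphic (coset_space G) (sphere R 3).
Proof.
move=> os.
apply: (@homeomorphic_coset_space _ (@fold_sphere R \o orbit_sphere_map rL nondeg) id).
- by move=> k; apply: continuous_comp;
    [exact: orbit_sphere_map_continuous|exact: fold_sphere_continuous].
- by move=> k; have [k1 <-] := fold_sphere_surj k;
    have [k2 <-] := orbit_sphere_map_surj k1; exists k2.
- exact: quotient_map_id.
- by move=> k k'; exact: orbit_sphere_map_fibre_even.
Qed.
End FixedGroup.
End Main.

Theorem theorem2 (R : realType) (G : groupClosed (SO R 3)) (n : nat)
    (cardG : [set` G] #= `I_n) :
  (~~ odd n -> homeomorphic (coset_space G) (sphere R 3)) /\
  (odd n -> homeomorphic (coset_space G) (projective_space R 3)).
Proof.
have [s [us <- rs s1 [sM sG]]] := finite_group_seq cardG.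
have [c rc nondeg] := generic_frame rs sM.
split=> on.
  exact: (coset_space_even us rs s1 sM sG rc nondeg).
exact: (coset_space_odd us rs s1 sM sG rc nondeg).
Qed.
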